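(* Let $\alpha\ge 1$ and $n\ge2$ be integers, and let $X_1,\ldots,X_n$ be independent random variables, each with density $(\Gamma(\alpha))^{-1}e^{-x}x^{\alpha-1}$, $x>0$. Let $\Phi$ be the angle between $(X_1,\ldots,X_n)$ and $(1,\ldots,1)$, and put $N=[(\alpha-1)n/2]$ (integer part). Then for $0\le t\le (n-1)^{-1/2}$, $$W_{\alpha,n}(t):=\Pr\{\tan\Phi\le t\}=\frac{\Gamma(\alpha n)}{(\Gamma(\alpha))^n n^{\alpha n/2}}\sum_{j=0}^{N}a_{\alpha,n,2j}\frac{t^{n-1+2j}}{n-1+2j},$$ where the coefficients $a_{\alpha,n,2j}$, $j=0,\ldots,N$, are given as the unique solution of the linear equations, for $m=0,\ldots,N$, $$\sum_{j=0}^{N}\Gamma\left(\tfrac12+\beta n+m-j\right)\Gamma\left(\tfrac{n-1}2+j\right)a_{\alpha,n,2j}=\begin{cases}\displaystyle 2\,\frac{(2m)!}{n^m}\sum_{(m)}\prod_{j=1}^n\frac{\Gamma(1/2+\beta+m_j)}{(2m_j)!}, & \text{if }\alpha=2\beta+1,\\[3ex] \displaystyle 2\,\frac{(2m+n)!}{n^{m+n/2}}\sum_{(m)}\prod_{j=1}^n\frac{\Gamma(1/2+\beta+m_j)}{(2m_j+1)!}, & \text{if }\alpha=2\beta,\end{cases}$$ with $\beta$ the integer determined by $\alpha=2\beta+1$ ($\alpha$ odd) or $\alpha=2\beta$ ($\alpha$ even).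
   Context: The symbol $\sum_{(m)}$ denotes summation over all decompositions $m=m_1+\cdots+m_n$ with non-negative integers $m_1,\ldots,m_n$. The angle $\Phi\in[0,\pi/2)$ satisfies $\sqrt n\cos\Phi=\big(\sum_iX_i\big)\big(\sum_iX_i^2\big)^{-1/2}$. *)

(* Defs.v *)
From HB Require Import structures.
From mathcomp Require Import all_boot all_order all_algebra.
From mathcomp Require Import all_classical all_reals all_analysis.
From mathcomp Require Import ring lra.

Set Implicit Arguments.
Unset Strict Implicit.
Unset Printing Implicit Defensive.

Import Order.TTheory GRing.Theory Num.Theory.
Import numFieldNormedType.Exports.

Local Open Scope classical_set_scope.
Local Open Scope ring_scope.

(* Euler's integral; only meaningful for 0 < x (for other x the integral
   diverges and [fine] returns 0). *)
Definition gamma (R : realType) (x : R) : R :=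
  fine (\int[lebesgue_measure]_(t in `]0%R, +oo[)
          (t `^ (x - 1) * expR (- t))%:E)%E.

(* Density of the standard gamma law with integer shape alpha >= 1. *)
Definition gamma_pdf (R : realType) (alpha : nat) (x : R) : R :=
  if 0 < x then (gamma alpha%:R)^-1 * expR (- x) * x ^+ (alpha - 1) else 0.

Definition has_density (d : measure_display) (T : measurableType d)
    (R : realType) (P : probability T R) (X : {RV P >-> R}) (f : R -> R) :=
  forall B : set R, measurable B ->
    distribution P X B = (\int[lebesgue_measure]_(x in B) (f x)%:E)%E.

Definition independent_RVs (d : measure_display) (T : measurableType d)
    (R : realType) (P : probability T R) (I : finType)
    (X : I -> {RV P >-> R}) :=
  forall (J : {set I}) (B : I -> set R), (forall i, measurable (B i)) ->
    P (\bigcap_(i in [set` J]) (X i @^-1` B i)) =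
    (\prod_(i in J) P (X i @^-1` B i))%E.

Definition angle (R : realType) (n : nat) (x y : 'I_n -> R) : R :=
  acos ((\sum_i x i * y i) /
        (Num.sqrt (\sum_i x i ^+ 2) * Num.sqrt (\sum_i y i ^+ 2))).

(* For vectors with positive coordinates, the angle with (1, ..., 1) is
   characterized by the equation for its cosine in [0, pi / 2). *)
Lemma angle_onesP (R : realType) (n : nat) (x : 'I_n -> R) (phi : R) :
  (0 < n)%N -> (forall i, 0 < x i) ->
  phi = angle x (fun=> 1) <->
  0 <= phi < pi / 2 /\
  Num.sqrt n%:R * cos phi = (\sum_i x i) * (Num.sqrt (\sum_i x i ^+ 2))^-1.
Proof.
move=> n0 x0; rewrite /angle.
under eq_bigr do rewrite mulr1.
have -> : \sum_(i < n) (1 : R) ^+ 2 = n%:R.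
  by under eq_bigr do rewrite expr1n; rewrite sumr_const card_ord.
set S := \sum_i x i; set Q := \sum_i x i ^+ 2.
have nR0 : 0 < n%:R :> R by rewrite ltr0n.
have S0 : 0 < S.
  rewrite /S; case: n n0 x x0 @S @Q nR0 => // n _ x x0 _ _ _.
  rewrite big_ord_recl ltr_pwDl//; apply: sumr_ge0 => i _; exact: ltW.
have Q0 : 0 < Q.
  rewrite /Q; case: n n0 x x0 @S @Q nR0 S0 => // n _ x x0 _ _ _ _.
  rewrite big_ord_recl ltr_pwDl ?exprn_gt0//.
  by apply: sumr_ge0 => i _; exact: sqr_ge0.
have CS : S ^+ 2 <= n%:R * Q.
  have : 0 <= \sum_i (n%:R * x i - S) ^+ 2.
    by apply: sumr_ge0 => i _; exact: sqr_ge0.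
  have -> : \sum_i (n%:R * x i - S) ^+ 2 = n%:R * (n%:R * Q - S ^+ 2).
    transitivity (\sum_i (n%:R ^+ 2 * x i ^+ 2 +
        (- 2 * n%:R * S) * x i + S ^+ 2)).
      by apply: eq_bigr => i _; ring.
    rewrite !big_split /= -!mulr_sumr -/Q -/S sumr_const card_ord -mulr_natr.
    by ring.
  by rewrite pmulr_rge0// subr_ge0.
set c := S / _.
have sQ0 : 0 < Num.sqrt Q by rewrite sqrtr_gt0.
have sn0 : 0 < Num.sqrt n%:R :> R by rewrite sqrtr_gt0.
have c0 : 0 < c by rewrite divr_gt0// mulr_gt0.
have c1 : c <= 1.
  rewrite ler_pdivrMr ?mulr_gt0// mul1r -(sqrtrM _ (ltW Q0)).
  by rewrite -(ger0_norm (ltW S0)) -sqrtr_sqr ler_wsqrtr// mulrC.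
have cE : S / Num.sqrt Q = Num.sqrt n%:R * c.
  by rewrite /c invfM; field; rewrite !gt_eqF.
have cI : -1 <= c <= 1 by rewrite c1 andbT (le_trans _ (ltW c0))// lerN10.
have pi0 := pi_gt0 R.
have cosc : cos (acos c) = c by rewrite acosK// in_itv.
split=> [->|[/andP[phi0 phi1]]].
  rewrite cE cosc acos_ge0//; split=> //=.
  rewrite -ltr_cos ?cos_pihalf ?cosc// in_itv /= ?acos_ge0 ?acos_lepi//.
  by apply/andP; split; lra.
rewrite cE => /(mulfI (lt0r_neq0 sn0)) <-.
by rewrite cosK// in_itv /= phi0 /=; lra.
Qed.

Definition poly_order (alpha n : nat) : nat := ((alpha - 1) * n)./2.

(* Here beta = alpha./2, i.e. alpha = 2 * beta + 1 or alpha = 2 * beta; each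
   m_i in a decomposition m = m_1 + ... + m_n is at most m, so 'I_m.+1 loses
   none of them. *)
Definition moment_rhs (R : realType) (alpha n m : nat) : R :=
  let beta := (alpha./2)%:R in
  if odd alpha then
    2 * ((2 * m)`!%:R / n%:R ^+ m) *
    \sum_(k : {ffun 'I_n -> 'I_m.+1} | (\sum_i k i)%N == m)
      \prod_i (gamma (1 / 2 + beta + (k i)%:R) / (2 * k i)`!%:R)
  else
    2 * ((2 * m + n)`!%:R / n%:R `^ (m%:R + n%:R / 2)) *
    \sum_(k : {ffun 'I_n -> 'I_m.+1} | (\sum_i k i)%N == m)
      \prod_i (gamma (1 / 2 + beta + (k i)%:R) / (2 * k i + 1)`!%:R).

(* [a j] stands for a_{alpha, n, 2 j}. *)
Definition coef_system (R : realType) (alpha n : nat)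
    (a : {ffun 'I_(poly_order alpha n).+1 -> R}) : Prop :=
  forall m : 'I_(poly_order alpha n).+1,
    \sum_(j < (poly_order alpha n).+1)
           gamma (1 / 2 + (alpha./2)%:R * n%:R + m%:R - j%:R) *
           gamma ((n%:R - 1) / 2 + j%:R) * a j
    = moment_rhs R alpha n m.

(* Main.v *)
From HB Require Import structures.
Require Import Defs.
From mathcomp Require Import all_boot all_order all_algebra.
From mathcomp Require Import all_classical all_reals all_analysis.
From mathcomp Require Import measurable_realfun.
From mathcomp Require Import ring lra zify.
Import Order.TTheory GRing.Theory Num.Theory.
Import numFieldNormedType.Exports.
Local Open Scope classical_set_scope.
Local Open Scope ring_scope.
Set Implicit Arguments.
Unset Strict Implicit.
Unset Printing Implicit Defensive.

(** Write [a = alpha - 1].  The condition [tan Phi <= t] only involves the sum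
[S] of the variables and their dispersion [W], the sum of squares minus
[S ^ 2 / n]: up to a null set it says [W <= t ^ 2 S ^ 2 / n].  When
[t <= (n - 1) ^ (- 1 / 2)], the points of R^n with this property and [S > 0]
form a cone inside the positive orthant, so there the joint density is the
polynomial [\prod x_i ^ a] times [exp (- S)] and no boundary is seen.  In
coordinates adapted to the diagonal, integrating a polynomial over the sphere
of radius [sqrt W] orthogonal to the diagonal keeps its even part only.  Hence
on the cone the law of [(S, W)] has the density
  [exp (- s) \sum_j e_j s ^ (a n - 2 j) w ^ ((n - 3) / 2 + j) / Gamma ((n - 1) / 2 + j)]
up to the normalizing constant, and integrating it over [w <= t ^ 2 s ^ 2 / n]
gives the claimed polynomial in [t], with [a_j] an explicit multiple of [e_j].

Spheres and rotations of R^n are avoided by adding the variables one at a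
time.  When [x] joins [c] variables with statistics [(s, w)], the new
statistics are [s + x] and [w + (c x - s) ^ 2 / (c (c + 1))] ([update]).  In the
coordinates [s' = s + x] and [u = x - s' / (c + 1)], the cone for [c + 1]
variables lies over the cone for [c] ([cone_update]), the new dispersion is
[w + (c + 1) / c u ^ 2], and the weight [x ^ a s ^ b] becomes a homogeneous
polynomial in [(s', u)] ([step_poly]).  Folding the line [u] onto the half-line
[u ^ 2] leaves a convolution of powers of half-integer exponent, which is
Euler's beta integral ([phi_conv]).  This gives the recursion [shape_coef] for
the [e_j]; the law on the cone is [cone_law_stat] and the probability is
[integral_cap_indicator].

The linear equations come from the same change of variables applied to the
Gaussian weight: their right-hand side is the integral over R^n of
[(\sum x_i) ^ r \prod x_i ^ a exp (- \sum x_i ^ 2)], expanded by the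
multinomial formula.  Because the integrand has no constant sign, this part is
done algebraically.  The invariance of the Gaussian weight under a rotation of
the plane is an identity between moments, read off from powers of linear forms
([gauss_rotation]); adding the variables one at a time, it expresses the moments
through the very same [shape_coef] ([gmom_shape]), which is the system
([coef_sol_system]).  Uniqueness holds because the matrix
[Gamma (q_j / 2 + m)] is a Vandermonde matrix up to row and column operations
([rising_system_eq0]). *)

(** * Integration on the line *)
Section line_integral.
Context {R : realType}.
Notation mu := (@lebesgue_measure R).
Notation mR := (measurableTypeR R).
Implicit Types (f : mR -> \bar R) (c : R).
Local Open Scope ereal_scope.

Lemma ge0_integral_translation f c : measurable_fun [set: mR] f ->
  (forall x, 0 <= f x) -> \int[mu]_x f (x + c)%R = \int[mu]_x f x.
Proof.
move=> mf f0.
have mph : measurable_fun [set: mR] ((fun x => x + c)%R : mR -> mR) by exact: measurable_funD.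
transitivity (\int[pushforward mu ((fun x => x + c)%R : mR -> mR)]_x f x).
  by rewrite (ge0_integral_pushforward mph) ?preimage_setT.
apply: eq_measure_integral => A mA _.
apply/esym/lebesgue_measure_unique => //= _ [[a b]] _ <-.
rewrite /pushforward [X in _ = mu X](_ : _ = [set` `](a - c)%R, (b - c)%R]]).
  rewrite !lebesgue_measure_itv/= !lte_fin ltrD2r.
  by case: ifPn => //; rewrite -!EFinB => _; congr EFin; ring.
by apply/seteqP; split => x /=; rewrite !in_itv/= => /andP[? ?]; apply/andP; split; lra.
Qed.

Lemma ge0_integral_scaling f c : (0 < c)%R -> measurable_fun [set: mR] f ->
  (forall x, 0 <= f x) -> \int[mu]_x f (c * x)%R = c^-1%:E * \int[mu]_x f x.
Proof.
move=> c0 mf f0.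
have mph : measurable_fun [set: mR] ((fun x => c * x)%R : mR -> mR) by exact: measurable_funM.
have [nu nuE] : exists nu : {measure set mR -> \bar R},
    forall A, nu A = pushforward mu ((fun x => c * x)%R : mR -> mR) A.
  by unshelve eexists; first exact: (pushforward mu ((fun x => c * x)%R : mR -> mR)).
have muE A : measurable A -> mu A = mscale (NngNum (ltW c0)) nu A.
  move=> mA; apply/lebesgue_measure_unique => //= _ [[a b]] _ <-.
  rewrite /mscale/= nuE /pushforward.
  rewrite [X in _ = _ * mu X](_ : _ = [set` `](a / c)%R, (b / c)%R]]).
    rewrite !lebesgue_measure_itv/= !lte_fin ltr_pM2r ?invr_gt0//.
    case: ifPn => _; rewrite ?mule0// -!EFinB -EFinM; congr EFin.
    by field; rewrite gt_eqF.
  by apply/seteqP; split => x /=;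
    rewrite !in_itv/= ltr_pdivrMr// ler_pdivlMr// (mulrC x).
rewrite [in RHS](eq_measure_integral (mscale (NngNum (ltW c0)) nu)); last first.
  by move=> A mA _; exact: muE.
rewrite ge0_integral_mscale//= muleA -EFinM mulVf ?gt_eqF// mul1e.
rewrite [RHS](eq_measure_integral (pushforward mu ((fun x => c * x)%R : mR -> mR))).
  by rewrite (ge0_integral_pushforward mph) ?preimage_setT.
by move=> A mA _; rewrite nuE.
Qed.

End line_integral.

Section density.
Context d (T : measurableType d) (R : realType).
Variables (mu nu : {measure set T -> \bar R}) (w : T -> R).
Hypotheses (mw : measurable_fun setT w) (w0 : forall x, 0 <= w x).
Local Open Scope ereal_scope.
Hypothesis nuE : forall A, measurable A -> nu A = \int[mu]_(x in A) (w x)%:E.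
Import HBNNSimple.

(** A measure given on sets by a density is handled by monotone approximation with simple functions. *)
Lemma ge0_integral_density (f : T -> \bar R) :
  measurable_fun setT f -> (forall x, 0 <= f x) ->
  \int[nu]_x f x = \int[mu]_x (f x * (w x)%:E).
Proof.
move=> mf f0; pose h := nnsfun_approx measurableT mf.
have cvh x : (EFin \o h n) x @[n --> \oo] --> f x by exact: cvg_nnsfun_approx.
have ndh x : {homo h^~ x : a b / (a <= b)%N >-> (a <= b)%R}.
  by move=> a b ab; exact/lefP/nd_nnsfun_approx.
have mwE : measurable_fun setT (EFin \o w) by exact/measurable_EFinP.
transitivity (limn (fun n => \int[nu]_x (h n x)%:E)).
  rewrite -monotone_convergence//.
  - by apply: eq_integral => x _; apply/esym/cvg_lim => //; exact: cvh.
  - by move=> n; exact/measurable_EFinP.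
  - by move=> n x _; rewrite lee_fin.
  - by move=> x _ a b ab; rewrite lee_fin ndh.
transitivity (limn (fun n => \int[mu]_x ((h n x)%:E * (w x)%:E))); last first.
  rewrite -monotone_convergence//.
  - apply: eq_integral => x _; apply/cvg_lim => //.
    by apply: cvgeZr => //; exact: cvh.
  - by move=> n; apply: emeasurable_funM => //; exact/measurable_EFinP.
  - by move=> n x _; rewrite mule_ge0// lee_fin.
  - by move=> x _ a b ab; rewrite lee_wpmul2r ?lee_fin ?w0 ?ndh.
congr (limn _); apply/funext => n.
under eq_integral do rewrite fimfunE -fsumEFin//.
rewrite ge0_integral_fsum//; last 2 first.
  - by move=> r; exact/measurable_EFinP/measurable_funM.
  - by move=> r x _; rewrite nnfun_muleindic_ge0.
under [RHS]eq_integral => x _.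
  rewrite fimfunE -fsumEFin// ge0_mule_fsuml; last first.
    by move=> r; rewrite nnfun_muleindic_ge0.
  over.
rewrite ge0_integral_fsum//; last 2 first.
  - move=> r; apply: emeasurable_funM => //.
    exact/measurable_EFinP/measurable_funM.
  - by move=> r x _; apply: mule_ge0; [exact: nnfun_muleindic_ge0|rewrite lee_fin].
apply: eq_fsbigr => r /[1!inE] -[t _ <-].
under eq_integral do rewrite EFinM.
rewrite integralZl_indic_nnsfun//.
under [RHS]eq_integral do rewrite EFinM -muleA.
have mi : measurable_fun setT (fun x => (\1_(h n @^-1` [set h n t]) x)%:E : \bar R).
  exact/measurable_EFinP.
rewrite ge0_integralZl//; last first.
  - by rewrite lee_fin.
  - by move=> x _; rewrite mule_ge0// lee_fin.
  - exact: emeasurable_funM.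
congr (_ * _).
rewrite integral_indic// setIT nuE//.
rewrite integral_mkcond; apply: eq_integral => x _.
by rewrite muleC epatch_indic.
Qed.

End density.

Section density_measure.
Context d (T : measurableType d) (R : realType).
Variables (mu : {measure set T -> \bar R}) (w : T -> R).
Hypotheses (mw : measurable_fun setT w) (w0 : forall x, 0 <= w x).
Local Open Scope ereal_scope.

Lemma exists_density_measure : exists nu : {measure set T -> \bar R},
  forall A, measurable A -> nu A = \int[mu]_(x in A) (w x)%:E.
Proof.
pose m A := \int[mu]_(x in A) (w x)%:E.
have m0 : m set0 = 0 by rewrite /m integral_set0.
have mge0 A : 0 <= m A by apply: integral_ge0 => x _; rewrite lee_fin.
have ms : semi_sigma_additive m.
  move=> F mF tF mUF; rewrite /m ge0_integral_bigcup//.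
  - apply: is_cvg_ereal_nneg_natsum_cond => n _ _; exact: mge0.
  - by apply/measurable_funTS/measurable_EFinP.
  - by move=> x _; rewrite lee_fin.
pose M := isMeasure.Build _ _ _ m m0 mge0 ms.
by exists (HB.pack m M : {measure set T -> \bar R}).
Qed.

End density_measure.

Lemma measurable_indr_lt d (T : measurableType d) (R : realType) (f g : T -> R) :
  measurable_fun setT f -> measurable_fun setT g ->
  measurable_fun setT (fun x => (f x < g x)%R%:R : R).
Proof.
move=> mf mg.
rewrite (_ : (fun _ => _) = \1_[set x | f x < g x]); last first.
  by apply/funext => x; rewrite indicE mem_setE.
by apply: measurable_indic; rewrite -[X in measurable X]setTI; exact: measurable_fun_ltr.
Qed.

Section square.
Context {R : realType}.
Notation mu := (@lebesgue_measure R).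
Notation mR := (measurableTypeR R).
Local Open Scope ereal_scope.

Lemma integral_double_id (a b : R) : (0 <= a)%R -> (a <= b)%R ->
  \int[mu]_(x in `]a, b]) (2 * x)%:E = (b ^+ 2 - a ^+ 2)%:E.
Proof.
move=> a0; rewrite le_eqVlt => /predU1P[->|ab].
  by rewrite subrr set_itv_ge ?bnd_simp ?ltxx// integral_set0.
have c2 : continuous (fun x : R => 2 * x)%R by move=> x; apply: cvgM => //; exact: cvg_cst.
rewrite integral_itv_obnd_cbnd; last first.
  by apply/measurable_EFinP/measurable_funTS; exact: measurable_funM.
rewrite (@continuous_FTC2 _ _ (fun x => x ^+ 2)%R) //.
- exact: continuous_subspaceT.
- split => [x _||].
  + exact: exprn_derivable.
  + by apply: cvg_at_right_filter; exact: exprn_continuous.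
  + by apply: cvg_at_left_filter; exact: exprn_continuous.
- move=> x _; rewrite derive1E exp_derive /=.
  by rewrite expr1 scaler_nat mulr_natl /GRing.scale/= mulr1.
Qed.

(** The substitution [v = x ^ 2] for arbitrary measurable integrands.  It is an
equality of measures, checked on intervals; going from [v] to [x] makes the
density [2 x] bounded near 0, so the fundamental theorem applies there.  The
negative half-line is completed by the Lebesgue measure itself so that
uniqueness of the Lebesgue measure can be used. *)
Lemma ge0_integral_square (f : mR -> \bar R) : measurable_fun [set: mR] f ->
  (forall x, 0 <= f x) ->
  \int[mu]_x (f x * ((0 < x)%R%:R)%:E) =
  \int[mu]_x (f (x ^+ 2)%R * ((0 < x)%R%:R * (2 * x))%:E).
Proof.
move=> mf f0.
pose w (u : mR) : R := ((0 < u)%R%:R * (2 * u))%R.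
have w0 u : (0 <= w u)%R.
  by rewrite /w; case: ltP => u0; rewrite ?mul0r// mul1r mulr_ge0// ltW.
have mw : measurable_fun [set: mR] w.
  by apply: measurable_funM; [exact: measurable_indr_lt|exact: measurable_funM].
have [nu0 nu0E] := exists_density_measure mu mw w0.
have msq : measurable_fun [set: mR] ((fun x => x ^+ 2)%R : mR -> mR).
  exact: exprn_measurable.
have [nu1 nu1E] : exists nu : {measure set mR -> \bar R},
    forall A, nu A = pushforward nu0 ((fun x => x ^+ 2)%R : mR -> mR) A.
  by unshelve eexists; first exact: (pushforward nu0 ((fun x => x ^+ 2)%R : mR -> mR)).
have mN : measurable (`]-oo, 0%R]%classic : set mR) by [].
pose nu2 := mrestr mu mN.
have muE A : measurable A -> mu A = measure_add nu1 nu2 A.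
  move=> mA; apply/lebesgue_measure_unique => // _ [[a b]] _ <- /=.
  transitivity (nu1 `]a, b]%classic + nu2 `]a, b]%classic); last first.
    by rewrite -measure_addE.
  have -> : nu1 `]a, b]%classic =
      \int[mu]_(x in `]Num.sqrt a, Num.sqrt b]) (2 * x)%:E.
    rewrite nu1E /pushforward/= nu0E; last first.
      by rewrite -[X in measurable X]setTI; exact: msq.
    rewrite [LHS]integral_mkcond [RHS]integral_mkcond; apply: eq_integral => x _.
    rewrite /patch/w; have [x0|x0] := ltP 0%R x; last first.
      rewrite mul0r if_same ifF//; apply/negP; rewrite inE/= in_itv/=.
      by apply/negP; rewrite negb_and -leNgt (le_trans x0) ?sqrtr_ge0.
    rewrite mul1r; congr (if _ then _ else _).
    apply/idP/idP; rewrite !inE/= !in_itv/=.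
      move=> /andP[ax xb]; rewrite -(ger0_norm (ltW x0)) -sqrtr_sqr.
      by rewrite ltr_sqrt ?exprn_gt0// ax ler_wsqrtr.
    move=> /andP[ax xb]; rewrite !ltNge.
    have b0 : (0 < b)%R by rewrite ltNge; apply: contraL xb => /ler0_sqrtr->; rewrite -ltNge.
    rewrite -[b]sqr_sqrtr ?(ltW b0)// lerXn2r ?nnegrE ?sqrtr_ge0 ?(ltW x0)// andbT.
    rewrite -ltNge; have [a0|a0] := ltP a 0%R; first by rewrite (lt_le_trans a0)// exprn_ge0 ?ltW.
    by rewrite -[a]sqr_sqrtr// ltrXn2r ?nnegrE ?sqrtr_ge0 ?(ltW x0).
  have -> : nu2 `]a, b]%classic = mu `]a, (Num.min b 0)%R].
    rewrite /nu2 /mrestr; congr (mu _); apply/seteqP; split => x/=; rewrite !in_itv/= le_min.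
      by move=> [/andP[-> ->] ->].
    by move=> /and3P[-> -> ->].
  have [ab|ba] := leP a b; last first.
    rewrite !lebesgue_measure_itv/= !lte_fin lt_min (ltNge a b) (ltW ba)/= adde0.
    by rewrite set_itv_ge ?integral_set0// bnd_simp -leNgt ler_wsqrtr// ltW.
  rewrite integral_double_id ?sqrtr_ge0 ?ler_wsqrtr//.
  have sq c : (Num.sqrt c ^+ 2 = Num.max c 0)%R.
    have [c0|c0] := leP c 0%R; first by rewrite ler0_sqrtr// expr0n.
    by rewrite sqr_sqrtr// ltW.
  rewrite !sq !lebesgue_measure_itv/= !lte_fin lt_min.
  case: ltP => ab'; last first.
    by have -> : a = b by [apply/eqP; rewrite eq_le ab ab']; rewrite subrr adde0.
  case: ltP => a0; rewrite -!EFinB -?EFinD; congr EFin.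
    by case: (lerP b 0%R) => b0; rewrite ?subr0 ?sub0r; lra.
  by case: (lerP b 0%R) => b0; rewrite ?subr0 ?sub0r ?addr0//; lra.
pose g x := f x * ((0 < x)%R%:R)%:E.
have mg : measurable_fun [set: mR] g.
  apply: emeasurable_funM => //; apply/measurable_EFinP; exact: measurable_indr_lt.
have g0 x : 0 <= g x by rewrite mule_ge0// lee_fin.
transitivity (\int[measure_add nu1 nu2]_x g x).
  by apply: eq_measure_integral => A mA _; exact: muE.
transitivity (\int[nu1]_x g x + \int[nu2]_x g x).
  by apply: ge0_integral_measure_add.
rewrite [X in _ + X](_ : _ = 0) ?adde0; last first.
  rewrite (_ : setT = `]-oo, 0%R]%classic `|` `]0%R, +oo[%classic); last first.
    by rewrite -setCitvr setvU.
  rewrite ge0_integral_setU//; last 2 first.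
    - by rewrite -setCitvr setvU.
    - rewrite disj_set2E; apply/eqP; rewrite -subset0 => x []/= /[!in_itv]/=.
      by rewrite leNgt andbT => /negP.
  rewrite [X in X + _](_ : _ = 0) ?add0e; last first.
    apply: integral0_eq => x/=; rewrite in_itv/= /g leNgt => /negbTE ->.
    by rewrite mule0.
  apply: null_set_integral => //; first exact: measurable_funTS.
  transitivity (mu (`]0%R, +oo[ `&` `]-oo, 0%R])%classic); first by [].
  rewrite [X in mu X](_ : _ = set0) ?measure0//.
  by rewrite -subset0 => x []/= /[!in_itv]/=; rewrite leNgt andbT => ->.
rewrite (eq_measure_integral (pushforward nu0 ((fun x => x ^+ 2)%R : mR -> mR))); last first.
  by move=> A mA _; rewrite nu1E.
rewrite (ge0_integral_pushforward msq) ?preimage_setT//.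
rewrite (ge0_integral_density mw w0 nu0E)//=; last exact: measurableT_comp.
apply: eq_integral => x _; rewrite /g /w; have [x0|x0] := ltP 0%R x.
  by rewrite exprn_gt0// mule1.
by rewrite mul0r !mule0.
Qed.

End square.

(** * Half-integer values of the gamma function *)
Section hpow.
Context {R : realType}.
Notation mu := (@lebesgue_measure R).
Notation mR := (measurableTypeR R).
Implicit Types (q : nat) (x c : R).

(** The function [x ^ (q / 2 - 1)] on the positive half-line, extended by 0.
Square roots keep all exponents natural. *)
Definition hpow q x : R := if 0 < x then Num.sqrt x ^+ q / x else 0.

Lemma hpow_ge0 q x : 0 <= hpow q x.
Proof. by rewrite /hpow; case: ifPn => // x0; rewrite divr_ge0 ?exprn_ge0 ?sqrtr_ge0 ?ltW. Qed.

Lemma hpow_le0 q x : x <= 0 -> hpow q x = 0.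
Proof. by rewrite /hpow leNgt => /negbTE ->. Qed.

Lemma measurable_hpow q : measurable_fun [set: mR] (hpow q : mR -> R).
Proof.
rewrite (_ : hpow q = fun x => (0 < x)%R%:R * (Num.sqrt x ^+ q * x `^ (-1))); last first.
  apply/funext => x; rewrite /hpow; case: ltP => x0; rewrite ?mul0r// mul1r.
  by rewrite powR_inv1// ltW.
apply: measurable_funM; first exact: measurable_indr_lt.
apply: measurable_funM; last exact: measurable_powR.
by apply: measurable_funX; apply: continuous_measurable_fun; exact: sqrt_continuous.
Qed.

Lemma hpowZ q c x : 0 < c -> hpow q (c * x) = Num.sqrt c ^+ q / c * hpow q x.
Proof.
move=> c0; rewrite /hpow pmulr_rgt0//; case: ifPn => x0; last by rewrite mulr0.
by rewrite sqrtrM ?ltW// exprMn; field; rewrite !gt_eqF.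
Qed.

Lemma hpow_sqr q x : 0 < x -> hpow q (x ^+ 2) = x ^+ q / x ^+ 2.
Proof. by move=> x0; rewrite /hpow exprn_gt0// sqrtr_sqr ger0_norm// ltW. Qed.

Lemma hpowS2 q x : 0 < x -> hpow q.+2 x = Num.sqrt x ^+ q.
Proof.
by move=> x0; rewrite /hpow x0 !exprSr -(mulrA (_ ^+ q)) -expr2 sqr_sqrtr ?ltW// mulfK// gt_eqF.
Qed.

Local Open Scope ereal_scope.

Lemma integral_hpow q x : (0 < q)%N -> (0 <= x)%R ->
  \int[mu]_y (hpow q y * (y < x)%R%:R)%:E = (2 / q%:R * Num.sqrt x ^+ q)%:E.
Proof.
move=> q0 x0; have qN0 : (q%:R != 0 :> R)%R by rewrite pnatr_eq0 -lt0n.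
pose f (y : mR) := (hpow q y * (y < x)%R%:R)%R.
have mf : measurable_fun [set: mR] (EFin \o f).
  apply/measurable_EFinP/measurable_funM; first exact: measurable_hpow.
  exact: measurable_indr_lt.
have f0 y : 0 <= (EFin \o f) y by rewrite lee_fin mulr_ge0// hpow_ge0.
transitivity (\int[mu]_y ((EFin \o f) y * ((0 < y)%R%:R)%:E)).
  apply: eq_integral => y _ /=; rewrite -EFinM /f; congr EFin.
  by have [y0|y0] := ltP 0%R y; rewrite ?mulr1// hpow_le0// !mul0r.
rewrite ge0_integral_square//.
transitivity (\int[mu]_(u in `]0%R, (Num.sqrt x)[) (2 * u ^+ q.-1)%:E).
  rewrite [RHS]integral_mkcond; apply: eq_integral => u _ /=.
  rewrite /patch -EFinM /f mem_setE in_itv/=.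
  have [u0|u0]/= := ltP 0%R u; last by rewrite mul0r mulr0.
  rewrite hpow_sqr// mul1r.
  have -> : (u ^+ 2 < x)%R = (u < Num.sqrt x)%R.
    by rewrite -[in LHS](sqr_sqrtr x0) ltr_pXn2r ?nnegrE ?sqrtr_ge0 ?(ltW u0).
  case: ifPn => _; rewrite ?mulr0 ?mul0r// mulr1; congr EFin.
  by rewrite -(prednK q0) [in LHS]exprS; field; rewrite gt_eqF.
have [->|xN0] := eqVneq x 0%R.
  by rewrite sqrtr0 expr0n gtn_eqF ?mulr0// set_itv_ge ?bnd_simp// integral_set0.
rewrite -(@integral_itv_bndoo _ _ _ _ true false); last first.
  by apply/measurable_EFinP/measurable_funTS; exact: measurable_funM.
rewrite (@continuous_FTC2 _ _ (fun u => 2 / q%:R * u ^+ q)%R) //.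
- by rewrite expr0n gtn_eqF// mulr0 sube0.
- by rewrite sqrtr_gt0 lt_neqAle eq_sym xN0.
- apply: continuous_subspaceT => y; apply: cvgM; first exact: cvg_cst.
  exact: exprn_continuous.
- split => [y _||].
  + by apply: derivableM => //; exact: exprn_derivable.
  + by apply: cvg_at_right_filter; apply: cvgM; [exact: cvg_cst|exact: exprn_continuous].
  + by apply: cvg_at_left_filter; apply: cvgM; [exact: cvg_cst|exact: exprn_continuous].
- move=> y _; rewrite derive1E deriveM//; last exact: exprn_derivable.
  rewrite derive_cst scaler0 addr0 exp_derive /GRing.scale/= mulr1.
  by rewrite -mulr_natl; field.
Qed.

Lemma integral_expRN_gt x :
  \int[mu]_y ((x < y)%R%:R * expR (- y))%:E = (expR (- x))%:E.
Proof.
have cexpN : continuous (fun y : R => expR (- y)).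
  by move=> y; apply: continuous_comp; [exact: opp_continuous|exact: continuous_expR].
transitivity (\int[mu]_(y in `]x, +oo[) (expR (- y))%:E).
  rewrite [RHS]integral_mkcond; apply: eq_integral => y _ /=.
  by rewrite /patch mem_setE in_itv/= andbT; case: ifPn; rewrite ?mul1r ?mul0r.
rewrite integral_itv_obnd_cbnd; last first.
  apply/measurable_EFinP/measurable_funTS; exact: continuous_measurable_fun.
rewrite (@ge0_continuous_FTC2y _ _ (fun y => - expR (- y))%R _ 0%R)//.
- by rewrite -EFinB sub0r opprK.
- exact: continuous_subspaceT.
- by rewrite -oppr0; apply: cvgN; exact: cvgr_expR.
- by apply: cvg_at_right_filter; apply: cvgN; exact: cexpN.
- move=> y _; rewrite derive1N// derive1_comp// derive1N// derive1_id.
  by rewrite derive1E; have /funeqP -> := @derive_expR R; rewrite mulrN1 opprK.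
Qed.

(** Euler's integral at [q / 2], as an extended real, so that finiteness can be proved by recursion. *)
Definition egamma q : \bar R := \int[mu]_x (hpow q x * expR (- x))%:E.

Lemma gamma_egamma q : gamma (q%:R / 2 : R) = fine (egamma q).
Proof.
rewrite /gamma /egamma; congr fine.
rewrite [LHS]integral_mkcond; apply: eq_integral => x _ /=.
rewrite /patch mem_setE in_itv/= andbT /hpow; case: ifPn => x0; last by rewrite mul0r.
rewrite powRB; last by rewrite (gt_eqF x0) implybT.
rewrite powRr1 ?ltW// (mulrC q%:R) powRrM.
by rewrite powR12_sqrt ?ltW// powR_mulrn ?sqrtr_ge0.
Qed.

Lemma egammaE q : (0 < q)%N ->
  egamma q = \int[mu]_x ((0 < x)%R%:R * (2 * x ^+ q.-1) * expR (- x ^+ 2))%:E.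
Proof.
move=> q0; pose f (y : mR) := (hpow q y * expR (- y))%R.
have mf : measurable_fun [set: mR] (EFin \o f).
  apply/measurable_EFinP/measurable_funM; first exact: measurable_hpow.
  by apply: measurableT_comp => //; exact: oppr_measurable.
have f0 y : 0 <= (EFin \o f) y by rewrite lee_fin mulr_ge0 ?hpow_ge0 ?expR_ge0.
transitivity (\int[mu]_y ((EFin \o f) y * ((0 < y)%R%:R)%:E)).
  apply: eq_integral => y _ /=; rewrite -EFinM /f; congr EFin.
  by have [y0|y0] := ltP 0%R y; rewrite ?mulr1// hpow_le0// !mul0r.
rewrite ge0_integral_square//; apply: eq_integral => u _ /=.
rewrite -EFinM /f; congr EFin.
have [u0|u0] := ltP 0%R u; last by rewrite !mul0r mulr0.
rewrite hpow_sqr// !mul1r -(prednK q0) exprS.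
by rewrite prednK//; field; rewrite gt_eqF.
Qed.

Lemma egamma1 : egamma 1 = (Num.sqrt pi)%:E.
Proof.
rewrite egammaE//.
transitivity (2%:E * \int[mu]_(x in `[0%R, +oo[) (gauss_fun x)%:E); last first.
  by rewrite integral0y_gauss -EFinM mulrC divfK.
have mg : measurable_fun [set: mR] (EFin \o gauss_fun (R:=R)).
  by apply/measurable_EFinP; exact: measurable_gauss_fun.
rewrite -ge0_integralZl//; last 2 first.
  exact: measurable_funTS.
  by move=> x _; rewrite lee_fin gauss_fun_ge0.
rewrite -integral_itv_obnd_cbnd; last first.
  by apply: measurable_funTS; exact: emeasurable_funM.
rewrite [RHS]integral_mkcond; apply: eq_integral => x _.
rewrite /patch mem_setE in_itv/= andbT -EFinM.
by case: ifPn; rewrite ?mul0r// mul1r expr0 mulr1.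
Qed.

Lemma egamma2 : egamma 2 = 1.
Proof.
transitivity ((expR (- 0))%:E : \bar R); last by rewrite oppr0 expR0.
rewrite -integral_expRN_gt; apply: eq_integral => x _; congr (_%:E).
have [x0|x0] := ltP 0%R x; last by rewrite hpow_le0.
by rewrite hpowS2// expr0.
Qed.

(** The functional equation of Gamma at half-integers.  Instead of integrating by
parts, both sides are read as a double integral over [0 < x < y], since
[x ^ (q / 2)] and [exp (- x)] are the integrals of [q / 2 y ^ (q / 2 - 1)] on
[y < x] and of [exp (- y)] on [y > x]. *)
Lemma egammaS2 q : (0 < q)%N -> egamma q.+2 = (q%:R / 2)%:E * egamma q.
Proof.
move=> q0; have qN0 : (q%:R != 0 :> R)%R by rewrite pnatr_eq0 -lt0n.
pose f (z : mR * mR) := (hpow q z.1 * ((z.1 < z.2)%R%:R * expR (- z.2)))%R.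
have mf : measurable_fun [set: mR * mR] (EFin \o f).
  apply/measurable_EFinP/measurable_funM.
    by apply: measurableT_comp => //; exact: measurable_hpow.
  apply: measurable_funM; first exact: measurable_indr_lt.
  by apply: measurableT_comp => //; apply: measurableT_comp => //; exact: oppr_measurable.
have f0 z : 0 <= (EFin \o f) z by rewrite lee_fin !mulr_ge0 ?hpow_ge0 ?expR_ge0.
have /= FT := @fubini_tonelli _ _ _ _ _ mu mu _ mf f0.
transitivity ((q%:R / 2)%:E * \int[mu]_x \int[mu]_y (f (x, y))%:E); last first.
  congr (_ * _); apply: eq_integral => x _; rewrite /f/=.
  under eq_integral do rewrite EFinM.
  rewrite ge0_integralZl_EFin; last 4 first.
  - exact: measurableT.
  - by move=> y _; rewrite lee_fin mulr_ge0 ?expR_ge0.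
  - apply/measurable_EFinP; apply: measurable_funM; first exact: measurable_indr_lt.
    by apply: measurableT_comp => //; exact: oppr_measurable.
  - exact: hpow_ge0.
  by rewrite integral_expRN_gt EFinM.
rewrite FT -ge0_integralZl_EFin; last 4 first.
- exact: measurableT.
- by move=> y _; apply: integral_ge0 => x _; exact: f0.
- have mG := @measurable_fun_fubini_tonelli_G _ _ _ _ _ mu _ mf f0; apply: mG.
- by rewrite divr_ge0.
apply: eq_integral => y _; rewrite /f/=.
under [in RHS]eq_integral do rewrite mulrA mulrC EFinM.
rewrite ge0_integralZl_EFin; last 4 first.
- exact: measurableT.
- by move=> x _; rewrite lee_fin mulr_ge0 ?hpow_ge0.
- apply/measurable_EFinP; apply: measurable_funM; first exact: measurable_hpow.
  exact: measurable_indr_lt.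
- exact: expR_ge0.
clear FT mf f0; have [y0|y0] := ltP 0%R y.
  rewrite (integral_hpow q0 (ltW y0)) (hpowS2 _ y0) -!EFinM; congr EFin.
  by field.
rewrite hpow_le0// mul0r [X in _ * (_ * X)](_ : _ = 0) ?mule0//.
apply: integral0_eq => x _; case: ltP => xy; rewrite ?mulr0//.
by rewrite hpow_le0 ?mul0r// (le_trans (ltW xy)).
Qed.

End hpow.

(** * Convolution of half-integer powers *)
Section phi.
Context {R : realType}.
Notation mu := (@lebesgue_measure R).
Notation mR := (measurableTypeR R).
Implicit Types (q r : nat) (x c w : R).

Lemma tonelli_line (F : mR -> mR -> \bar R) :
  measurable_fun [set: mR * mR] (fun z => F z.1 z.2) ->
  (forall x y, (0 <= F x y)%E) ->
  (\int[mu]_x \int[mu]_y F x y = \int[mu]_y \int[mu]_x F x y)%E.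
Proof.
move=> mF F0.
exact: (@fubini_tonelli _ _ _ _ _ mu mu (fun z => F z.1 z.2) mF (fun z => F0 _ _)).
Qed.

Definition hgamma q : R := gamma (q%:R / 2).

(** Induction by steps of two, from the Gaussian integral and the exponential integral. *)
Lemma hgamma_egamma q : (0 < q)%N -> 0 < hgamma q /\ egamma q = (hgamma q)%:E.
Proof.
suff H k p : (p < k)%N -> (0 < p)%N -> exists2 g, 0 < g & egamma p = g%:E :> \bar R.
  move=> q0; have [g g0 Eg] := H q.+1 q (ltnSn _) q0.
  by rewrite /hgamma gamma_egamma Eg.
elim: k p => // k IH [//|[|[|p]]] qk _.
- by exists (Num.sqrt pi); rewrite ?egamma1// sqrtr_gt0 pi_gt0.
- by exists 1; rewrite ?egamma2.
- have [|//|g g0 Eg] := IH p.+1; first by rewrite -ltnS (ltn_trans _ qk).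
  by exists (p.+1%:R / 2 * g); rewrite ?egammaS2// ?Eg// mulr_gt0// divr_gt0.
Qed.

Lemma hgamma_gt0 q : (0 < q)%N -> 0 < hgamma q.
Proof. by case/hgamma_egamma. Qed.

Lemma egamma_hgamma q : (0 < q)%N -> egamma q = (hgamma q)%:E.
Proof. by case/hgamma_egamma. Qed.

Lemma hgammaS2 q : (0 < q)%N -> hgamma q.+2 = q%:R / 2 * hgamma q.
Proof. by move=> q0; have := @egammaS2 R _ q0; rewrite !egamma_hgamma// => -[]. Qed.

(** The kernel of the Riemann-Liouville integral of order [q / 2].  With this
normalization the kernels form a convolution semigroup. *)
Definition phi q x : R := hpow q x / hgamma q.

Lemma phi_le0 q x : x <= 0 -> phi q x = 0.
Proof. by move=> x0; rewrite /phi hpow_le0// mul0r. Qed.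

Lemma phi_ge0 q x : (0 < q)%N -> 0 <= phi q x.
Proof. by move=> q0; rewrite divr_ge0 ?hpow_ge0// ltW ?hgamma_gt0. Qed.

Lemma measurable_phi q : measurable_fun [set: mR] (phi q : mR -> R).
Proof. by apply: measurable_funM => //; exact: measurable_hpow. Qed.

Lemma phiZ q c x : 0 < c -> phi q (c * x) = Num.sqrt c ^+ q / c * phi q x.
Proof. by move=> c0; rewrite /phi hpowZ// mulrA. Qed.

Lemma measurable_expRN : measurable_fun [set: mR] ((fun x => expR (- x)) : mR -> R).
Proof. by apply: measurableT_comp => //; exact: oppr_measurable. Qed.

Local Open Scope ereal_scope.

Lemma integral_phi_expRN q : (0 < q)%N ->
  \int[mu]_x (phi q x * expR (- x))%:E = 1.
Proof.
move=> q0; have g0 := hgamma_gt0 q0.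
transitivity ((hgamma q)^-1%:E * egamma q); last first.
  by rewrite egamma_hgamma// -EFinM mulVf// gt_eqF.
rewrite -ge0_integralZl_EFin; last 4 first.
- exact: measurableT.
- by move=> x _; rewrite lee_fin mulr_ge0 ?hpow_ge0 ?expR_ge0.
- apply/measurable_EFinP/measurable_funM; first exact: measurable_hpow.
  exact: measurable_expRN.
- by rewrite invr_ge0 ltW.
by apply: eq_integral => x _; rewrite -EFinM /phi mulrAC mulrA mulrC mulrA.
Qed.

Let conv q r w := \int[mu]_v (phi q v * phi r (w - v))%:E.

Let mconv q r w : measurable_fun [set: mR]
  (fun v : mR => (phi q v * phi r (w - v))%:E).
Proof.
apply/measurable_EFinP/measurable_funM; first exact: measurable_phi.
apply: (measurableT_comp (measurable_phi r)).
by apply: measurable_funB.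
Qed.

Let conv_scale q r w : (0 < q)%N -> (0 < r)%N -> (0 < w)%R ->
  conv q r w = (hpow (q + r) w)%:E * conv q r 1.
Proof.
move=> q0 r0 w0.
have H := ge0_integral_scaling w0 (mconv q r w)
  (fun x => (ltac:(by rewrite lee_fin mulr_ge0 ?phi_ge0) : 0 <= (phi q x * phi r (w - x))%:E)).
transitivity (w%:E * (w^-1%:E * conv q r w)).
  by rewrite muleA -EFinM divff ?gt_eqF// mul1e.
rewrite /conv -H.
rewrite -!ge0_integralZl_EFin; last 8 first.
- exact: measurableT.
- by move=> x _; rewrite lee_fin mulr_ge0 ?phi_ge0.
- exact: mconv.
- exact: hpow_ge0.
- exact: measurableT.
- by move=> x _; rewrite lee_fin mulr_ge0 ?phi_ge0.
- apply: (measurableT_comp (mconv q r w)).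
  exact: measurable_funM.
- exact: ltW.
apply: eq_integral => x _; rewrite -!EFinM; congr EFin.
have -> : (w - w * x = w * (1 - x))%R by ring.
rewrite !phiZ// /hpow w0 exprD. by field; rewrite gt_eqF.
Qed.

(** Euler's beta integral.  By scaling, the convolution is a constant multiple of
[w ^ ((q + r) / 2 - 1)]; integrating against [exp (- w)] turns it into a product
of two integrals equal to 1, which determines the constant. *)
Lemma phi_conv q r w : (0 < q)%N -> (0 < r)%N ->
  \int[mu]_v (phi q v * phi r (w - v))%:E = (phi (q + r) w)%:E.
Proof.
move=> q0 r0; rewrite -/(conv q r w).
have qr0 : (0 < q + r)%N by rewrite addn_gt0 q0.
have convN x : (x <= 0)%R -> conv q r x = 0.
  move=> x0; apply: integral0_eq => v _; have [v0|v0] := leP v 0%R.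
    by rewrite phi_le0// mul0r.
  by rewrite (@phi_le0 r) ?mulr0//; lra.
have conv_ge0 x : 0 <= conv q r x.
  by apply: integral_ge0 => v _; rewrite lee_fin mulr_ge0 ?phi_ge0.
have convE x : conv q r x = (hpow (q + r) x)%:E * conv q r 1.
  have [x0|x0] := ltP 0%R x; first exact: conv_scale.
  by rewrite convN// hpow_le0// mul0e.
have [w0|w0] := ltP 0%R w; last by rewrite convN// phi_le0.
(* only the value of the constant remains *)
suff : (hgamma (q + r))%:E * conv q r 1 = 1.
  have g0 := hgamma_gt0 qr0.
  move=> H; rewrite conv_scale// /phi [RHS]EFinM; congr (_ * _).
  transitivity ((hgamma (q + r))^-1%:E * ((hgamma (q + r))%:E * conv q r 1)).
    by rewrite muleA -EFinM mulVf ?gt_eqF// mul1e.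
  by rewrite H mule1.
rewrite -egamma_hgamma// /egamma.
pose F (x v : mR) := ((phi q v * phi r (x - v)) * expR (- x))%:E.
have F0 x v : 0 <= F x v.
  by rewrite lee_fin; apply: mulr_ge0; [apply: mulr_ge0; exact: phi_ge0|exact: expR_ge0].
have mF : measurable_fun [set: mR * mR] (fun z => F z.1 z.2).
  apply/measurable_EFinP/measurable_funM.
    apply: measurable_funM; first by apply: (measurableT_comp (measurable_phi q)).
    apply: (measurableT_comp (measurable_phi r)).
    exact: measurable_funB.
  by apply: (measurableT_comp measurable_expRN).
transitivity (\int[mu]_x \int[mu]_v F x v).
  rewrite muleC -ge0_integralZl; last 4 first.
  - exact: measurableT.
  - apply/measurable_EFinP/measurable_funM; first exact: measurable_hpow.
    exact: measurable_expRN.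
  - by move=> x _; rewrite lee_fin mulr_ge0 ?hpow_ge0 ?expR_ge0.
  - exact: conv_ge0.
  apply: eq_integral => x _; rewrite EFinM muleA (muleC (conv q r 1)) -convE muleC.
  rewrite /conv -ge0_integralZl_EFin; last 4 first.
  - exact: measurableT.
  - by move=> v _; rewrite lee_fin mulr_ge0 ?phi_ge0.
  - exact: mconv.
  - exact: expR_ge0.
  by apply: eq_integral => v _; rewrite -EFinM mulrC.
rewrite tonelli_line//.
transitivity (\int[mu]_v (phi q v * expR (- v))%:E); last exact: integral_phi_expRN.
apply: eq_integral => v _.
have mG : measurable_fun [set: mR] (fun x : mR => F x v).
  apply/measurable_EFinP/measurable_funM; last exact: measurable_expRN.
  apply: measurable_funM => //; apply: (measurableT_comp (measurable_phi r)).
  exact: measurable_funB.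
(* undo the shift of the second kernel *)
rewrite -(ge0_integral_translation v mG)//.
rewrite -[RHS]mule1 -(integral_phi_expRN r0) -ge0_integralZl_EFin; last 4 first.
- exact: measurableT.
- by move=> x _; rewrite lee_fin mulr_ge0 ?phi_ge0 ?expR_ge0.
- apply/measurable_EFinP/measurable_funM; first exact: measurable_phi.
  exact: measurable_expRN.
- by rewrite mulr_ge0 ?phi_ge0 ?expR_ge0.
apply: eq_integral => x _; rewrite /F -EFinM; congr EFin.
have -> : (x + v - v = x)%R by ring.
have -> : (- (x + v) = - x + - v)%R by ring.
by rewrite expRD; ring.
Qed.

End phi.

(** * Gaussian moments and their rotation invariance *)
Section gauss_moments.
Context {R : realType}.
Implicit Types (x y : R) (m l i : nat).

(** The moment of order [l] of the weight [exp (- x ^ 2)] on the line. *)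
Definition gmom l : R := if odd l then 0 else hgamma l.+1.

Lemma gmom_odd l : odd l -> gmom l = 0.
Proof. by rewrite /gmom => ->. Qed.

Lemma gmom_double i : gmom (2 * i) = hgamma (2 * i).+1.
Proof. by rewrite /gmom oddM. Qed.

Lemma gmom_doubleE i : gmom (2 * i) = (2 * i)`!%:R / (4 ^+ i * i`!%:R) * hgamma 1.
Proof.
elim: i => [|i IH]; first by rewrite gmom_double muln0 expr0 fact0 mul1r divr1 mul1r.
rewrite gmom_double (_ : (2 * i.+1).+1 = (2 * i).+3)%N; last by lia.
rewrite hgammaS2; last exact: ltn0Sn.
rewrite -gmom_double IH.
rewrite (_ : (2 * i.+1)%N = (2 * i).+2)%N; last by lia.
rewrite !factS !natrM exprS.
have f1 : i`!%:R != 0 :> R by rewrite pnatr_eq0 -lt0n fact_gt0.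
have f2 : 4 ^+ i != 0 :> R by rewrite expf_neq0.
have f3 : i.+1%:R != 0 :> R by rewrite pnatr_eq0.
rewrite (_ : (2 * i).+2%:R = 2 * i.+1%:R :> R); last by rewrite -natrM; congr _%:R; lia.
by field; rewrite ?nat1r ?natr1 f1 f2 f3.
Qed.

(** The integral of [(x X + y Y) ^ m exp (- X ^ 2 - Y ^ 2)] over the plane, expanded
by the binomial formula. *)
Definition gauss_form m x y : R :=
  \sum_(l < m.+1) 'C(m, l)%:R * x ^+ (m - l) * y ^+ l * (gmom (m - l) * gmom l).

Lemma gauss_form_odd m x y : odd m -> gauss_form m x y = 0.
Proof.
move=> om; rewrite /gauss_form big1// => l _.
have lm : (l <= m)%N by rewrite -ltnS.
case/boolP: (odd l) => ol; first by rewrite (gmom_odd ol) !mulr0.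
by rewrite (@gmom_odd (m - l)) ?mul0r ?mulr0// oddB// om (negbTE ol).
Qed.

Lemma sum_evens (F : nat -> R) m : (forall l, odd l -> F l = 0) ->
  \sum_(l < (2 * m).+1) F l = \sum_(i < m.+1) F (2 * i)%N.
Proof.
move=> F0; elim: m => [|m IH]; first by rewrite !big_ord_recr !big_ord0.
rewrite (_ : (2 * m.+1).+1 = (2 * m).+3)%N; last by lia.
rewrite !big_ord_recr/= in IH *; rewrite IH (F0 (2 * m).+1) ?addr0; last by rewrite /= oddM.
by congr (_ + F _); lia.
Qed.

Lemma gauss_form_even m x y : gauss_form (2 * m) x y =
  (2 * m)`!%:R / (4 ^+ m * m`!%:R) * hgamma 1 ^+ 2 * (x ^+ 2 + y ^+ 2) ^+ m.
Proof.
rewrite /gauss_form (sum_evens (F := fun l => 'C(2 * m, l)%:R * x ^+ (2 * m - l) * y ^+ l *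
  (gmom (2 * m - l) * gmom l))); last by move=> l ol; rewrite (gmom_odd ol) !mulr0.
rewrite (exprDn (x ^+ 2)) mulr_sumr; apply: eq_bigr => -[i /= im] _.
rewrite -mulnBr !gmom_doubleE !exprM -mulr_natl.
have f1 k : k`!%:R != 0 :> R by rewrite pnatr_eq0 -lt0n fact_gt0.
have f2 k : 4 ^+ k != 0 :> R by rewrite expf_neq0.
have <- : 'C(2 * m, 2 * i)%:R * (2 * i)`!%:R * (2 * (m - i))`!%:R = (2 * m)`!%:R :> R.
  by rewrite -!natrM -mulnA mulnBr bin_fact//; lia.
have <- : 'C(m, i)%:R * i`!%:R * (m - i)`!%:R = m`!%:R :> R.
  by rewrite -!natrM -mulnA bin_fact.
have <- : 4 ^+ i * 4 ^+ (m - i) = 4 ^+ m :> R by rewrite -exprD subnKC.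
have f3 : 'C(m, i)%:R != 0 :> R by rewrite pnatr_eq0 -lt0n bin_gt0.
by field; rewrite ?f1 ?f2 ?f3.
Qed.

(** Rotation invariance of the Gaussian weight: a power of a linear form only sees
the length of its vector of coefficients. *)
Lemma gauss_form_isometry m x y x' y' : x ^+ 2 + y ^+ 2 = x' ^+ 2 + y' ^+ 2 ->
  gauss_form m x y = gauss_form m x' y'.
Proof.
move=> e; case/boolP: (odd m) => om; first by rewrite !gauss_form_odd.
have -> : m = (2 * m./2)%N by rewrite mul2n even_halfK.
by rewrite !gauss_form_even e.
Qed.

End gauss_moments.

Section rotation.
Context {R : realType}.
Implicit Types (x y : R) (a b c e m l i : nat) (p : {poly R}).

(** The weight [x ^ a s ^ b] in the coordinates [s' = 1] and [u = 'X], where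
[x = s' / (c + 1) + u] and [s = c / (c + 1) s' - u]; homogeneity recovers
other values of [s']. *)
Definition step_poly c a b : {poly R} :=
  ((c.+1%:R^-1)%:P + 'X) ^+ a * ((c%:R / c.+1%:R)%:P - 'X) ^+ b.

(** The new dispersion gains [(step_scale c * u) ^ 2]. *)
Definition step_scale c : R := Num.sqrt (c.+1%:R / c%:R).

Lemma step_scale_gt0 c : (0 < c)%N -> 0 < step_scale c.
Proof. by move=> c0; rewrite sqrtr_gt0 divr_gt0 ?ltr0n. Qed.

Lemma sqrt_step c : (0 < c)%N ->
  Num.sqrt c.+1%:R = step_scale c * Num.sqrt c%:R :> R.
Proof.
move=> c0; rewrite /step_scale -sqrtrM ?divr_ge0//.
by rewrite divfK// pnatr_eq0 -lt0n.
Qed.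

(** The integral over the plane of the form of degree [m] that restricts to [p] on
[s' = 1], against [exp (- s' ^ 2 / (c + 1) - (step_scale c * u) ^ 2)]. *)
Definition rotated_form c m p : R := \sum_(l < m.+1)
  p`_l * (Num.sqrt c.+1%:R ^+ (m - l).+1 * gmom (m - l)) *
  (step_scale c ^- l.+1 * gmom l).

Lemma rotated_form_sum c m (I : Type) (s : seq I) (F : I -> R) (G : I -> {poly R}) :
  rotated_form c m (\sum_(i <- s) F i *: G i) = \sum_(i <- s) F i * rotated_form c m (G i).
Proof.
rewrite /rotated_form; under [RHS]eq_bigr do rewrite mulr_sumr.
rewrite exchange_big/=; apply: eq_bigr => l _.
rewrite coef_sum 2!mulr_suml; apply: eq_bigr => i _.
by rewrite coefZ !mulrA.
Qed.

Lemma rotated_form_linear_exp c m x y : (0 < c)%N ->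
  rotated_form c m ((x%:P + y *: 'X) ^+ m) =
  Num.sqrt c%:R * gauss_form m (Num.sqrt c.+1%:R * x) (y / step_scale c).
Proof.
move=> c0; rewrite /rotated_form /gauss_form mulr_sumr; apply: eq_bigr => -[l /= lm] _.
have s0 := step_scale_gt0 c0.
have -> : ((x%:P + y *: 'X) ^+ m)`_l = 'C(m, l)%:R * x ^+ (m - l) * y ^+ l.
  rewrite exprDn coef_sum (bigD1 (Ordinal lm))//= big1 ?addr0.
    by rewrite coefMn exprZn -rmorphXn/= mul_polyC coefZ coefZ coefXn eqxx mulr1 mulr_natl mulrnAl.
  move=> [i im] /=; rewrite -val_eqE/= => il.
  by rewrite coefMn exprZn -rmorphXn/= mul_polyC !coefZ coefXn eq_sym (negbTE il) !mulr0 mul0rn.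
rewrite exprMn exprMn exprS sqrt_step// exprVn exprS.
by field; rewrite expf_neq0 ?gt_eqF.
Qed.

(** The quadratic form [s ^ 2 / c + x ^ 2] equals [s' ^ 2 / (c + 1)] plus
[(step_scale c * u) ^ 2], with Jacobian 1, so the two sides are the same
Gaussian integral of [x ^ e s ^ b].  For powers of a linear form this is
[gauss_form_isometry]; the powers [(s + x0 x) ^ m], as polynomials in [x0],
separate the monomials. *)
Lemma gauss_rotation c b e : (0 < c)%N ->
  Num.sqrt c%:R ^+ b.+1 * gmom b * gmom e = rotated_form c (b + e) (step_poly c e b).
Proof.
move=> c0; set m := (b + e)%N.
pose L k : R := Num.sqrt c%:R ^+ (m - k).+1 * gmom (m - k) * gmom k.
pose Rk k := rotated_form c m (step_poly c k (m - k)).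
suff H k : (k <= m)%N -> L k = Rk k.
  have := H e; rewrite /L /Rk /m addnK; apply; exact: leq_addl.
(* a polynomial vanishing at every real number is 0, which compares the monomials *)
pose Q : {poly R} := \poly_(k < m.+1) ('C(m, k)%:R * (L k - Rk k)).
suff Q0 : Q = 0.
  move=> km; have := congr1 (fun p : {poly R} => p`_k) Q0.
  rewrite coef0 coef_poly ltnS km => /eqP; rewrite mulf_eq0 pnatr_eq0 -leqn0 leqNgt bin_gt0 km/=.
  by rewrite subr_eq0 => /eqP.
have Qx x : Q.[x] = 0.
  rewrite horner_poly.
  under eq_bigr do rewrite mulrBr mulrBl.
  rewrite big_split/= sumrN; apply/eqP; rewrite subr_eq0; apply/eqP.
  transitivity (Num.sqrt c%:R * gauss_form m (Num.sqrt c%:R) x).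
    rewrite /gauss_form mulr_sumr; apply: eq_bigr => -[j /= jm] _.
    by rewrite /L exprS; ring.
  pose p0 : R := c.+1%:R^-1; pose p1 : R := c%:R / c.+1%:R.
  have cN : c%:R + 1 != 0 :> R by rewrite natr1 pnatr_eq0.
  have cN0 : c%:R != 0 :> R by rewrite pnatr_eq0 -lt0n.
  rewrite (gauss_form_isometry _ (x' := Num.sqrt c.+1%:R * (p1 + x * p0))
      (y' := (x - 1) / step_scale c)); last first.
    rewrite /step_scale !exprMn exprVn !sqr_sqrtr ?divr_ge0// /p0 /p1 -natr1.
    by field; rewrite cN cN0.
  rewrite -rotated_form_linear_exp//.
  have -> : ((p1 + x * p0)%:P + (x - 1) *: 'X) ^+ m =
      \sum_(k < m.+1) ('C(m, k)%:R * x ^+ k) *: step_poly c k (m - k).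
    have -> : (p1 + x * p0)%:P + (x - 1) *: 'X = (p1%:P - 'X) + x *: (p0%:P + 'X).
      by rewrite -!mul_polyC !(polyCD, polyCN, polyCM, polyC1); ring.
    rewrite exprDn; apply: eq_bigr => -[j /= jm] _.
    by rewrite exprZn -scalerAr -scaler_nat scalerA /step_poly [in LHS](mulrC (_ ^+ (m - j))).
  rewrite rotated_form_sum; apply: eq_bigr => j _.
  by rewrite -/(Rk j) mulrAC.
apply/eqP/negPn/negP => Qn0.
have := @max_poly_roots _ Q [seq i%:R | i <- iota 0 (size Q)] Qn0.
rewrite size_map size_iota ltnn => /(_ _ _)/negP; apply=> //.
  by apply/allP => _ /mapP[i _ ->]; rewrite /root Qx.
by rewrite map_inj_uniq ?iota_uniq// => i j /eqP; rewrite eqr_nat => /eqP.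
Qed.

End rotation.

(** * Shape coefficients and moments *)
Section sums.
Context {V : nmodType}.

Lemma sum_ord_widen (F : nat -> V) M N : (M <= N)%N ->
  (forall l, (M <= l)%N -> F l = 0) -> \sum_(l < M) F l = \sum_(l < N) F l.
Proof.
move=> MN F0; rewrite (big_ord_widen _ _ MN) [RHS](bigID (fun l : 'I_N => (l < M)%N))/=.
by rewrite [X in _ + X]big1 ?addr0// => l; rewrite -leqNgt => /F0.
Qed.

(** The shape of a Cauchy product. *)
Lemma sum_triangle (G : nat -> nat -> V) N :
  \sum_(j < N) \sum_(i < j.+1) G i (j - i)%N = \sum_(i < N) \sum_(h < N - i) G i h.
Proof.
transitivity (\sum_(j < N) \sum_(i < N | (i < j.+1)%N) G i (j - i)%N).
  by apply: eq_bigr => j _; rewrite (big_ord_widen N (fun i => G i (j - i)%N)).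
rewrite (exchange_big_dep xpredT)//=; apply: eq_bigr => i _.
transitivity (\sum_(i <= j < N) G i (j - i)%N).
  by rewrite big_geq_mkord; apply: eq_bigl => j; rewrite ltnS.
rewrite -{1}(add0n i) big_addn big_mkord.
by apply: eq_bigr => h _; rewrite addnK.
Qed.

End sums.

Lemma sum_evens_trunc (R : realType) (F : nat -> R) M H :
  (forall l, odd l -> F l = 0) -> (forall l, (M <= l)%N -> F l = 0) ->
  (forall h, (H <= h)%N -> F (2 * h)%N = 0) ->
  \sum_(l < M) F l = \sum_(h < H) F (2 * h)%N.
Proof.
move=> Fo FM FH.
rewrite (@sum_ord_widen _ F M (2 * (M + H)).+1)//; last by lia.
by rewrite sum_evens// -(@sum_ord_widen _ (fun h => F (2 * h)%N) H)//; lia.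
Qed.

Section shape.
Context {R : realType}.
Variable a : nat.
Implicit Types (c r k i j h l m : nat).

(** [shape_coef k j] is the coefficient [e_j] for [k.+1] variables.  Only the even
powers of [u] in [step_poly] survive; the power [2 i] contributes the factor
[hgamma (2 * i).+1 / step_scale ^ (2 * i).+1], its Gaussian moment. *)
Fixpoint shape_coef k : nat -> R :=
  if k is k'.+1 then fun j => \sum_(i < j.+1)
    ((step_poly k'.+1 a (a * k'.+1 - 2 * i))`_(2 * (j - i)) *
     (step_scale k'.+1 ^- (2 * (j - i)).+1 * hgamma (2 * (j - i)).+1) *
     shape_coef k' i)
  else fun j => (j == 0)%:R.

Lemma coef_step_poly_eq0 c b l : (a + b < l)%N -> (step_poly c a b : {poly R})`_l = 0.
Proof.
move=> abl; apply: nth_default; apply: leq_trans (size_polyMleq _ _) _.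
have H1 : (size (((c.+1%:R^-1)%:P + 'X) ^+ a : {poly R}) <= a.+1)%N.
  by rewrite addrC -[_%:P]opprK -polyCN size_exp_XsubC.
have H2 : (size (((c%:R / c.+1%:R)%:P - 'X) ^+ b : {poly R}) <= b.+1)%N.
  rewrite (_ : _ - 'X = (-1) *: ('X - (c%:R / c.+1%:R)%:P)); last first.
    by rewrite scaleN1r opprB.
  by rewrite exprZn (leq_trans (size_scale_leq _ _))// size_exp_XsubC.
move: H1 H2 abl; move: (size _) (size _) => u v *; lia.
Qed.

Lemma shape_coef_eq0 k j : (a * k.+1 < 2 * j)%N -> shape_coef k j = 0.
Proof.
elim: k j => [|k IH] j akj /=; first by case: j akj => //; rewrite muln0.
apply: big1 => -[i /= ij] _.
have [aki|aki] := ltnP (a * k.+1) (2 * i); first by rewrite (IH _ aki) mulr0.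
by rewrite coef_step_poly_eq0 ?mul0r//; nia.
Qed.

(** The truncated exponential generating function of the moments of
[x ^ a exp (- x ^ 2)]; its powers encode the multinomial formula. *)
Definition gmom_poly L : {poly R} := \poly_(l < L.+1) (gmom (l + a) / l`!%:R).

(** Both sides are the integral over R^(k.+1) of
[(\sum x_i) ^ r \prod x_i ^ a exp (- \sum x_i ^ 2)], computed in the original
coordinates and in those adapted to the diagonal.  The factor
[hgamma (k + 2 * j)] coming from the dispersion cancels the normalization of
[shape_coef]. *)
Lemma gmom_shape L k r N : (r <= L)%N -> (a * k.+1 <= (2 * N).+1)%N ->
  r`!%:R * (gmom_poly L ^+ k.+1)`_r = \sum_(j < N.+1) shape_coef k j *
     (Num.sqrt k.+1%:R ^+ (r + (a * k.+1 - 2 * j)).+1 * gmom (r + (a * k.+1 - 2 * j))).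
Proof.
have fN0 l : l`!%:R != 0 :> R by rewrite pnatr_eq0 -lt0n fact_gt0.
elim: k r => [|k IH] r rL aN.
  rewrite big_ord_recl big1 ?addr0/=; last by move=> i _; rewrite mul0r.
  rewrite expr1 coef_poly ltnS rL muln0 subn0 muln1 mul1r sqrtr1 expr1n mul1r.
  by rewrite mulrC divfK.
set c := k.+1 in IH *.
have c0 : (0 < c)%N by [].
pose b j := (a * c - 2 * j)%N.
transitivity (\sum_(j < N.+1) shape_coef k j * rotated_form c (r + b j + a) (step_poly c a (b j))).
  rewrite exprS coefM mulr_sumr.
  transitivity (\sum_(l < r.+1) \sum_(j < N.+1) shape_coef k j *
      ('C(r, l)%:R * rotated_form c (r + b j + a) (step_poly c (l + a) (r - l + b j)))).
    apply: eq_bigr => -[l /= lr] _.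
    rewrite coef_poly (leq_trans lr)//.
    have -> : r`!%:R = 'C(r, l)%:R * l`!%:R * (r - l)`!%:R :> R.
      by rewrite -!natrM -mulnA bin_fact.
    transitivity ('C(r, l)%:R * gmom (l + a) * ((r - l)`!%:R * (gmom_poly L ^+ c)`_(r - l))).
      by field.
    rewrite IH; [|lia|lia].
    rewrite mulr_sumr; apply: eq_bigr => j _.
    have -> : (r + b j + a = r - l + b j + (l + a))%N by lia.
    by rewrite -gauss_rotation// /b; ring.
  rewrite exchange_big/=; apply: eq_bigr => j _; rewrite -mulr_sumr; congr (_ * _).
  rewrite -rotated_form_sum; congr rotated_form.
  have -> : step_poly c a (b j) = step_poly c a (b j) *
      ((c.+1%:R^-1)%:P + 'X + ((c%:R / c.+1%:R)%:P - 'X)) ^+ r :> {poly R}.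
    rewrite [X in X ^+ r](_ : _ = 1) ?expr1n ?mulr1//.
    rewrite addrACA subrr addr0 -polyCD (_ : _ + _ = 1)// -natr1.
    by field; rewrite natr1 pnatr_eq0.
  rewrite addrC exprDn mulr_sumr; apply: eq_bigr => -[l /= lr] _.
  by rewrite /step_poly !exprD scaler_nat mulrnAr; congr (_ *+ _); ring.
rewrite /=; under [RHS]eq_bigr do rewrite mulr_suml.
pose G i h := (step_poly c a (b i))`_(2 * h) *
  (step_scale c ^- (2 * h).+1 * hgamma (2 * h).+1) * shape_coef k i *
  (Num.sqrt c.+1%:R ^+ (r + (a * c.+1 - 2 * (i + h))).+1 * gmom (r + (a * c.+1 - 2 * (i + h)))) : R.
transitivity (\sum_(j < N.+1) \sum_(i < j.+1) G i (j - i)%N); last first.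
  apply: eq_bigr => j _; apply: eq_bigr => -[i /= ij] _.
  by rewrite /G -/c subnKC.
rewrite sum_triangle; apply: eq_bigr => -[i /= iN] _.
have [aki|aki] := ltnP (a * c) (2 * i).
  by rewrite shape_coef_eq0// mul0r big1// => h _; rewrite /G shape_coef_eq0// mulr0 mul0r.
rewrite /rotated_form (sum_evens_trunc (F := fun l => (step_poly c a (b i))`_l *
    (Num.sqrt c.+1%:R ^+ (r + b i + a - l).+1 * gmom (r + b i + a - l)) *
    (step_scale c ^- l.+1 * gmom l)) (H := (N.+1 - i)%N)).
- rewrite mulr_sumr; apply: eq_bigr => -[h /= hN] _; rewrite /G gmom_double.
  have [abh|abh] := ltnP (a + b i) (2 * h).
    by rewrite coef_step_poly_eq0// !mul0r mulr0.
  have -> : (r + b i + a - 2 * h = r + (a * c.+1 - 2 * (i + h)))%N by rewrite /b in abh *; nia.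
  by ring.
- by move=> l ol; rewrite (gmom_odd ol) !mulr0.
- by move=> l lm; rewrite coef_step_poly_eq0 ?mul0r//; lia.
- by move=> h hN; rewrite coef_step_poly_eq0 ?mul0r// /b; nia.
Qed.

End shape.

(** * The linear system for the coefficients *)
Section rising_system.
Context {R : realType}.
Implicit Types (x : R) (p : {poly R}).

Definition rising_poly m : {poly R} := \prod_(i < m) ('X - (- i%:R)%:P).

Lemma hgamma_rising q m : (0 < q)%N ->
  hgamma (2 * m + q) = (rising_poly m).[q%:R / 2] * hgamma q.
Proof.
move=> q0; elim: m => [|m IH]; first by rewrite /rising_poly big_ord0 hornerC mul1r.
rewrite (_ : 2 * m.+1 + q = (2 * m + q).+2)%N; last by lia.
rewrite hgammaS2; last by rewrite addn_gt0 q0 orbT.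
rewrite IH.
have -> : rising_poly m.+1 = rising_poly m * ('X - (- m%:R)%:P).
  by rewrite /rising_poly big_ord_recr.
by rewrite hornerM hornerXsubC natrD natrM; field.
Qed.

(** The rising factorials of degree at most [N] span the polynomials of degree at
most [N]; testing against the Lagrange polynomials of the nodes isolates each
unknown. *)
Lemma rising_system_eq0 N (x b : 'I_N.+1 -> R) : injective x ->
  (forall m, (m <= N)%N -> \sum_j b j * (rising_poly m).[x j] = 0) ->
  forall j, b j = 0.
Proof.
move=> xinj bR.
have span s p : (s <= N.+1)%N -> (size p <= s)%N -> \sum_j b j * p.[x j] = 0.
  elim: s p => [|s IH] p sN.
    rewrite leqn0 size_poly_eq0 => /eqP ->.
    by apply: big1 => j _; rewrite horner0 mulr0.
  (* subtracting the leading term lowers the degree *)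
  move=> ps; pose p' := p - p`_s *: rising_poly s.
  have rs : size (rising_poly s) = s.+1.
    by rewrite /rising_poly size_prod_XsubC /index_enum -enumT size_enum_ord.
  have rm : (rising_poly s)`_s = 1.
    have : rising_poly s \is monic by apply: monic_prod_XsubC.
    by move/monicP; rewrite lead_coefE rs.
  have sp' : (size p' <= s)%N.
    apply/leq_sizeP => i; rewrite leq_eqVlt => /predU1P[<-|si].
      by rewrite coefB coefZ rm mulr1 subrr.
    by rewrite coefB coefZ (nth_default _ (leq_trans ps si)) [X in _ * X]nth_default ?rs// mulr0 subrr.
  have -> : p = p' + p`_s *: rising_poly s by rewrite subrK.
  under eq_bigr do rewrite hornerD hornerZ mulrDr mulrCA.
  rewrite big_split/= IH//; last exact: ltnW.
  by rewrite -mulr_sumr bR// mulr0 addr0.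
move=> j; pose p := \prod_(i < N.+1 | i != j) ('X - (x i)%:P).
have sp : (size p <= N.+1)%N.
  rewrite /p -big_filter size_prod_XsubC; have [e _ _ [_ ->]] := big_enumP.
  by rewrite (cardC1 j) card_ord.
have := span _ _ (leqnn _) sp.
rewrite (bigD1 j)//= [X in _ + X]big1 ?addr0.
  move=> /eqP; rewrite mulf_eq0 => /orP[/eqP//|].
  rewrite horner_prod prodf_seq_eq0 => /hasP[i _ /andP[ij]].
  by rewrite !hornerE subr_eq0 => /eqP/xinj ji; rewrite ji eqxx in ij.
move=> i ij; rewrite horner_prod (bigD1 i)//= hornerXsubC subrr mul0r mulr0//.
Qed.

End rising_system.

Section multinomial.
Context {R : comNzRingType}.

Lemma eq_coef_exp (p q : {poly R}) m n : (forall l, (l <= m)%N -> p`_l = q`_l) ->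
  forall r, (r <= m)%N -> (p ^+ n)`_r = (q ^+ n)`_r.
Proof.
move=> pq; elim: n => [//|n IH] r rm.
rewrite !exprS !coefM; apply: eq_bigr => -[l /= lr] _.
by rewrite pq ?IH//; lia.
Qed.

(** The multinomial formula, for a polynomial truncated at the degree of interest. *)
Lemma coef_poly_exp (c : nat -> R) m n :
  ((\poly_(i < m.+1) c i) ^+ n)`_m =
  \sum_(k : {ffun 'I_n -> 'I_m.+1} | (\sum_i k i)%N == m) \prod_i c (k i).
Proof.
rewrite -[n in LHS]card_ord -prodr_const poly_def.
rewrite bigA_distr_bigA/= coef_sum [RHS]big_mkcond/=; apply: eq_bigr => k _.
under eq_bigr do rewrite -mul_polyC.
rewrite big_split/= prodrXr -rmorph_prod/= mul_polyC coefZ coefXn eq_sym.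
by case: ifP; rewrite ?mulr1 ?mulr0.
Qed.

End multinomial.

Section coefficients.
Context {R : realType}.
Variables alpha n : nat.
Hypotheses (alpha0 : (0 < alpha)%N) (n2 : (2 <= n)%N).
Let n0 : (0 < n)%N. Proof. exact: ltnW. Qed.
Let a := (alpha - 1)%N.
Let N := poly_order alpha n.

(** The factor [Num.sqrt n ^ _] collects the powers of [n] from [W <= t ^ 2 S ^ 2 / n]
and from the prefactor of the distribution function. *)
Definition coef_sol : {ffun 'I_(poly_order alpha n).+1 -> R} :=
  [ffun j : 'I_(poly_order alpha n).+1 => 2 * shape_coef (alpha - 1) n.-1 j *
     Num.sqrt n%:R ^+ ((alpha - 1) * n - 2 * j).+1 / hgamma (n - 1 + 2 * j)].

Let leN : (a * n <= (2 * N).+1)%N.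
Proof. by rewrite /N /poly_order -/a; have := odd_double_half (a * n); lia. Qed.

Let Nle : (2 * N <= a * n)%N.
Proof. by rewrite /N /poly_order -/a; have := odd_double_half (a * n); lia. Qed.

Let Nb : (2 * N <= 2 * (alpha./2 * n))%N.
Proof. by have := odd_double_half alpha; move: Nle; rewrite /a; nia. Qed.

Lemma gamma_leftE m j : (2 * j <= 2 * (alpha./2 * n))%N ->
  gamma (1 / 2 + (alpha./2)%:R * n%:R + m%:R - j%:R : R) =
  hgamma (2 * m + (2 * (alpha./2 * n) - 2 * j).+1).
Proof.
move=> jN; rewrite /hgamma; congr gamma.
have -> : (2 * m + (2 * (alpha./2 * n) - 2 * j).+1)%:R =
    2 * m%:R + (2 * ((alpha./2)%:R * n%:R) - 2 * j%:R) + 1 :> R.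
  by rewrite natrD -natr1 natrB// !natrM addrA.
by field.
Qed.

Lemma gamma_rightE j : gamma ((n%:R - 1) / 2 + j%:R : R) = hgamma (n - 1 + 2 * j).
Proof.
rewrite /hgamma; congr gamma.
by rewrite natrD natrB// natrM; field.
Qed.

Lemma gamma_rhsE i : gamma (1 / 2 + (alpha./2)%:R + i%:R : R) = hgamma (2 * i + (2 * alpha./2).+1).
Proof.
rewrite /hgamma; congr gamma.
by rewrite natrD -natr1 !natrM; field.
Qed.

Let od := if odd alpha then 0%N else 1%N.

Let a_od : (a + od = 2 * alpha./2)%N.
Proof. by have := odd_double_half alpha; rewrite /od /a; case: (odd alpha); lia. Qed.

Let odd_a : odd a = odd od.
Proof. by have := congr1 odd a_od; rewrite oddD oddM/=; case: (odd a); case: (odd od). Qed.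

(** Parity decides which exponents contribute: for odd [alpha] every variable occurs
with an even power of itself from the multinomial expansion, for even [alpha]
with an odd one, which shifts the total degree by [n]. *)
Lemma moment_rhsE m (r := (2 * m + od * n)%N) :
  moment_rhs R alpha n m = 2 * (r`!%:R / Num.sqrt n%:R ^+ r) *
    (gmom_poly a (2 * (m + n)).+1 ^+ n)`_r.
Proof.
pose c i : R := gamma (1 / 2 + (alpha./2)%:R + i%:R) / (2 * i + od)`!%:R.
have -> : moment_rhs R alpha n m = 2 * (r`!%:R / Num.sqrt n%:R ^+ r) *
    \sum_(k : {ffun 'I_n -> 'I_m.+1} | (\sum_i k i)%N == m) \prod_i c (k i).
  rewrite /moment_rhs /r /c /od; case: ifP => _.
    rewrite mul0n addn0 exprM sqr_sqrtr//; congr (_ * _).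
    by apply: eq_bigr => k _; apply: eq_bigr => i _; rewrite addn0.
  rewrite mul1n; congr (_ * (_ / _) * _).
  rewrite powRD ?pnatr_eq0 ?gtn_eqF ?implybT// powR_mulrn// exprD exprM sqr_sqrtr//.
  by rewrite (mulrC n%:R) powRrM powR12_sqrt// powR_mulrn ?sqrtr_ge0.
congr (_ * _); rewrite -coef_poly_exp.
pose p : {poly R} := \poly_(i < (m + n).+1) c i.
transitivity ((p ^+ n)`_m).
  apply: eq_coef_exp (leqnn m) => l lm; rewrite !coef_poly ltnS lm ifT//; lia.
have -> : gmom_poly a (2 * (m + n)).+1 = 'X^od * (p \Po 'X^2) :> {poly R}.
  apply/polyP => l; rewrite coefXnM coef_poly coef_comp_poly_Xn//.
  have [ol|ol] := boolP (odd (l + od)).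
    rewrite gmom_odd ?mul0r ?if_same; last by move: ol; rewrite !oddD odd_a.
    case: ltnP => // odl; rewrite ifF// dvdn2 oddB//; move: ol; rewrite oddD.
    by case: (odd l); case: (odd od).
  have [i ->] : exists i, l = (2 * i + od)%N.
    exists l./2; move: ol; have := odd_double_half l; rewrite /od -mul2n.
    by case: (odd alpha); case: (odd l); rewrite ?addn0 ?addn1 /=; lia.
  have -> : (2 * i + od < od)%N = false by apply/negbTE; rewrite -leqNgt leq_addl.
  rewrite addnK dvdn_mulr// mulKn// coef_poly.
  have -> : (2 * i + od < (2 * (m + n)).+2)%N = (i < (m + n).+1)%N.
    by rewrite /od; case: (odd alpha); lia.
  case: ifP => // _; rewrite /c gamma_rhsE; congr (_ / _).
  rewrite /gmom ifF; last by rewrite -addnA oddD oddM /= oddD odd_a addbb.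
  by congr hgamma; move: a_od; lia.
rewrite exprMn -exprM coefXnM /r ifF; last by apply/negbTE; rewrite -leqNgt leq_addl.
by rewrite addnK -rmorphXn/= coef_comp_poly_Xn// dvdn_mulr// mulKn.
Qed.

Let an_od : (a * n + od * n = 2 * (alpha./2 * n))%N.
Proof. by rewrite -mulnDl a_od mulnA. Qed.

Lemma coef_sol_system : coef_system coef_sol.
Proof.
move=> [m /= mN]; rewrite moment_rhsE.
set r := (2 * m + od * n)%N.
have sn0 : Num.sqrt n%:R != 0 :> R by rewrite gt_eqF// sqrtr_gt0 ltr0n.
have -> : 2 * (r`!%:R / Num.sqrt n%:R ^+ r) * (gmom_poly a (2 * (m + n)).+1 ^+ n)`_r =
    2 * Num.sqrt n%:R ^- r * (r`!%:R * (gmom_poly a (2 * (m + n)).+1 ^+ n)`_r) :> R by ring.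
have -> : gmom_poly a (2 * (m + n)).+1 ^+ n = gmom_poly a (2 * (m + n)).+1 ^+ n.-1.+1 :> {poly R}.
  by rewrite prednK.
rewrite (@gmom_shape _ _ _ _ r N); last 2 first.
- by rewrite /r /od; case: (odd alpha); lia.
- by rewrite prednK.
rewrite mulr_sumr; apply: eq_bigr => -[j /= jN] _.
rewrite ffunE/= gamma_leftE; last by move: jN Nb; rewrite /N; lia.
rewrite gamma_rightE prednK// /gmom ifF.
- have -> : (r + (a * n - 2 * j)).+1 = (2 * m + (2 * (alpha./2 * n) - 2 * j).+1)%N.
    by move: jN Nle an_od; rewrite -/N /r; lia.
  have -> : Num.sqrt n%:R ^+ (2 * m + (2 * (alpha./2 * n) - 2 * j).+1) =
    Num.sqrt n%:R ^+ r * Num.sqrt n%:R ^+ (a * n - 2 * j).+1 :> R.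
    by rewrite -exprD; congr (_ ^+ _); move: jN Nle an_od; rewrite -/N /r; lia.
  have h0 : hgamma (n - 1 + 2 * j) != 0 :> R.
    by rewrite gt_eqF// hgamma_gt0//; lia.
  by rewrite -/a; field; rewrite h0 expf_neq0.
- have -> : (r + (a * n - 2 * j) = 2 * (m + (alpha./2 * n - j)))%N.
    by move: jN Nle an_od; rewrite -/N /r; lia.
  by rewrite oddM.
Qed.

Lemma coef_sol_unique : unique (@coef_system R alpha n) coef_sol.
Proof.
split; first exact: coef_sol_system.
move=> b bS; apply/ffunP => j; apply/eqP; rewrite -subr_eq0; apply/eqP.
pose q (i : 'I_N.+1) := (2 * (alpha./2 * n) - 2 * i).+1.
pose d (i : 'I_N.+1) : R := hgamma (q i) * hgamma (n - 1 + 2 * i) * (coef_sol i - b i).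
have qinj : injective (fun i : 'I_N.+1 => (q i)%:R / 2 : R).
  move=> i k /(divIf _)/eqP; rewrite pnatr_eq0 eqr_nat => /(_ isT)/eqP.
  rewrite /q => -[] ik; apply/val_inj => /=; move: (ltn_ord i) (ltn_ord k) Nb ik; lia.
have : d j = 0.
  apply: (rising_system_eq0 qinj) => m mN.
  have mN' : (m < N.+1)%N by rewrite ltnS.
  have := bS (Ordinal mN'); rewrite -(coef_sol_system (Ordinal mN')) /= => /esym/eqP.
  rewrite -subr_eq0 -sumrB => /eqP H; rewrite -[RHS]H; apply: eq_bigr => i _.
  rewrite gamma_leftE; last by move: (ltn_ord i) Nb; rewrite /N; lia.
  by rewrite gamma_rightE hgamma_rising// /d -/(q i); ring.
move=> /eqP; rewrite /d !mulf_eq0 => /orP[/orP[]|/eqP//].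
  by rewrite gt_eqF ?hgamma_gt0.
by rewrite gt_eqF// hgamma_gt0//; lia.
Qed.

End coefficients.

(** * Recursive statistics of independent variables *)
(** Measurable rectangles form a pi-system generating the product sigma-algebra. *)
Lemma measure_unique_rect d1 d2 (T1 : measurableType d1) (T2 : measurableType d2)
    (R : realType) (m1 m2 : {measure set (T1 * T2) -> \bar R}) :
  (m1 setT < +oo)%E ->
  (forall A B, measurable A -> measurable B -> m1 (A `*` B) = m2 (A `*` B)) ->
  forall C, measurable C -> m1 C = m2 C.
Proof.
move=> m1oo m12 C mC.
pose G : set (set (T1 * T2)) :=
  [set C | exists A, measurable A /\ exists B, measurable B /\ C = A `*` B].
apply: (measure_unique G (fun=> setT)) => //.
- rewrite measurable_prod_measurableType //; congr (<<s _ >>).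
  rewrite predeqE => E; split => [[A mA [B mB <-]]|[A [mA [B [mB ->]]]]].
    by exists A; split => //; exists B.
  by exists A => //; exists B.
- move=> /= _ _ [X1 [mX1 [X2 [mX2 ->]]]] [Y1 [mY1 [Y2 [mY2 ->]]]].
  rewrite -setXI; exists (X1 `&` Y1); split; first exact: measurableI.
  by exists (X2 `&` Y2); split => //; exact: measurableI.
- by move=> n; exists setT; split => //; exists setT; rewrite setXTT.
- by apply/seteqP; split => // x _; exists 0%N.
- by move=> E [A [mA [B [mB ->]]]]; exact: m12.
Qed.

Section independent_recursion.
Context d (T : measurableType d) (R : realType) (P : probability T R).
Notation mR := (measurableTypeR R).
Variables (n : nat) (X : 'I_n -> {RV P >-> R}).
Hypothesis hX : independent_RVs X.
Context d' (S : measurableType d').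
Variables (z0 : S) (h : nat -> S * mR -> S).
Hypothesis mh : forall k, measurable_fun setT (h k).

(** Indexing by natural numbers lets the recursion run past the last variable. *)
Definition rv_at k (w : T) : mR := if insub k is Some i then X i w else 0.

Lemma rv_atE k (kn : (k < n)%N) : rv_at k = X (Ordinal kn).
Proof. by apply/funext => w; rewrite /rv_at insubT. Qed.

Lemma measurable_rv_at k : measurable_fun setT (rv_at k).
Proof.
rewrite /rv_at; case: insubP => [i _ _|_]; last exact: measurable_cst.
exact: (measurable_funPT (X i)).
Qed.

Fixpoint rv_rec k (w : T) : S :=
  if k is k'.+1 then h k' (rv_rec k' w, rv_at k' w) else z0.

Lemma measurable_rv_rec k : measurable_fun setT (rv_rec k).
Proof.
elim: k => [|k IH] /=; first exact: measurable_cst.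
apply: (measurableT_comp (mh k)).
by apply: measurable_fun_pair => //; exact: measurable_rv_at.
Qed.

Definition indices_from k : {set 'I_n} := [set i : 'I_n | (k <= i)%N].

(** The event on which the past of a recursion is independent of the remaining variables. *)
Definition future k (B : 'I_n -> set mR) : set T :=
  \bigcap_(i in [set` indices_from k]) (X i @^-1` B i).

Lemma measurable_future k B : (forall i, measurable (B i)) ->
  measurable (future k B).
Proof.
move=> mB; apply: fin_bigcap_measurable => // i _.
exact: (measurable_funPTI (X i) (mB i)).
Qed.

Lemma prob_future k (kn : (k < n)%N) (B : 'I_n -> set mR) (D : set mR) :
  (forall i, measurable (B i)) -> measurable D ->
  let B' i := if i == Ordinal kn then D else B i in
  future k B' = rv_at k @^-1` D `&` future k.+1 B /\
  P (future k B') = (P (rv_at k @^-1` D) * P (future k.+1 B))%E.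
Proof.
move=> mB mD B'.
have mB' i : measurable (B' i) by rewrite /B'; case: ifP.
have JE : indices_from k = (Ordinal kn |: indices_from k.+1)%SET.
  apply/setP => i; rewrite !inE leq_eqVlt; congr (_ || _).
  by rewrite -val_eqE eq_sym.
have kJ : Ordinal kn \notin indices_from k.+1 by rewrite inE ltnn.
have BB' i : i \in indices_from k.+1 -> B' i = B i.
  by rewrite /B'; case: eqP => // ->; rewrite (negbTE kJ).
split.
  rewrite /future rv_atE; apply/seteqP; split => w /=.
    move=> wB; split=> [|i /= iJ].
      by have := wB (Ordinal kn); rewrite /B' eqxx; apply; rewrite /= JE !inE eqxx.
    by have := wB i; rewrite BB'//; apply; rewrite /= JE !inE -[(_ < _)%N]/(_ <= _)%N; move: iJ; rewrite inE => ->; rewrite orbT.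
  move=> [wD wB] i /=; rewrite JE => /setU1P[->|iJ]; first by rewrite /B' eqxx.
  by rewrite BB'//; exact: wB.
rewrite /future hX// hX// JE big_setU1//= {1}/B' eqxx -rv_atE; congr (_ * _)%E.
by apply: eq_bigr => i iJ; rewrite BB'.
Qed.

(** Induction on [k]: once the event on the later variables is fixed, both sides are
measures in the pair made of the past and the next variable, and they agree on
rectangles by the induction hypothesis. *)
Lemma rv_rec_indep k B A : (k <= n)%N -> (forall i, measurable (B i)) -> measurable A ->
  (P (rv_rec k @^-1` A `&` future k B) = P (rv_rec k @^-1` A) * P (future k B))%E.
Proof.
elim: k B A => [|k IH] B A kn mB mA.
  have [z0A|z0A] := pselect (A z0).
    rewrite (_ : rv_rec 0 @^-1` A = setT); last by apply/seteqP; split.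
    by rewrite setTI probability_setT mul1e.
  rewrite (_ : rv_rec 0 @^-1` A = set0); last by apply/seteqP; split.
  by rewrite set0I measure0 mul0e.
have mE := measurable_future k.+1 mB.
pose Z (w : T) := (rv_rec k w, rv_at k w).
have mZ : measurable_fun setT Z.
  by apply: measurable_fun_pair; [exact: measurable_rv_rec|exact: measurable_rv_at].
have [m1 m1E] : exists m : {measure set (S * mR) -> \bar R},
    forall C, m C = P (Z @^-1` C `&` future k.+1 B).
  by unshelve eexists; first exact: (pushforward (mrestr P mE) Z).
have cfin : P (future k.+1 B) \is a fin_num by exact: fin_num_measure.
pose c := fine (P (future k.+1 B)).
have c0 : 0 <= c by rewrite fine_ge0.
have [m2 m2E] : exists m : {measure set (S * mR) -> \bar R},
    forall C, m C = (P (future k.+1 B) * P (Z @^-1` C))%E.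
  unshelve eexists; first exact: (mscale (NngNum c0) (pushforward P Z)).
  by move=> C; rewrite /= /mscale/= /c fineK.
have -> : rv_rec k.+1 @^-1` A = Z @^-1` (h k @^-1` A) by [].
rewrite -m1E muleC -m2E; apply: measure_unique_rect.
- rewrite m1E; apply: le_lt_trans (_ : 1 < +oo)%E; last by rewrite ltry.
  by apply: probability_le1; rewrite preimage_setT setTI.
- move=> A' D mA' mD; rewrite m1E m2E.
  have -> : Z @^-1` (A' `*` D) = rv_rec k @^-1` A' `&` rv_at k @^-1` D by [].
  have [e1 p1] := prob_future kn mB mD.
  have [e2 p2] := @prob_future k kn (fun=> setT) D (fun=> measurableT) mD.
  have fT : future k.+1 (fun=> setT) = setT.
    by apply/seteqP; split => // w _ i _.
  rewrite -setIA -e1 IH// ?p1; [|exact: ltnW| by move=> i; case: ifP].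
  rewrite fT setIT in e2; rewrite fT probability_setT mule1 in p2.
  rewrite -e2 IH//; [|exact: ltnW| by move=> i; case: ifP].
  by rewrite p2 [RHS]muleC muleA.
- by rewrite -[X in measurable X]setTI; exact: mh.
Qed.

Local Open Scope ereal_scope.

(** Integration over the next variable, given the past. *)
Lemma ge0_integral_rv_rec k (rho : mR -> R) (Psi : S * mR -> \bar R) :
  (k < n)%N -> measurable_fun setT rho -> (forall x, 0 <= rho x)%R ->
  (forall i B, measurable B ->
     P (X i @^-1` B) = \int[lebesgue_measure]_(x in B) (rho x)%:E) ->
  measurable_fun setT Psi -> (forall z, 0 <= Psi z) ->
  \int[P]_w Psi (rv_rec k w, rv_at k w) =
  \int[P]_w \int[lebesgue_measure]_x (Psi (rv_rec k w, x) * (rho x)%:E).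
Proof.
move=> kn mrho rho0 Xrho mPsi Psi0.
have mZk := measurable_rv_rec k.
pose Zk : {RV P >-> S} := HB.pack (rv_rec k) (isMeasurableFun.Build _ _ _ _ _ mZk).
have mXk := measurable_rv_at k.
pose Xk : {RV P >-> mR} := HB.pack (rv_at k) (isMeasurableFun.Build _ _ _ _ _ mXk).
have mZ : measurable_fun setT (fun w => (rv_rec k w, rv_at k w)) by exact: measurable_fun_pair.
transitivity (\int[pushforward P (fun w => (rv_rec k w, rv_at k w))]_z Psi z).
  by rewrite ge0_integral_pushforward ?preimage_setT.
transitivity (\int[distribution P Zk \x distribution P Xk]_z Psi z).
  apply: eq_measure_integral => C mC _; symmetry.
  apply: product_measure_unique => // A D mA mD.
  have mB (i : 'I_n) : measurable ((fun=> setT : set mR) i) by [].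
  have [e p] := prob_future kn mB mD.
  have fT : future k.+1 (fun=> setT) = setT.
    by apply/seteqP; split => // w _ i _.
  rewrite fT setIT in e; rewrite fT probability_setT mule1 in p.
  transitivity (P (rv_rec k @^-1` A `&` rv_at k @^-1` D)); first by [].
  transitivity (P (rv_rec k @^-1` A) * P (rv_at k @^-1` D)); last by [].
  rewrite -p -e; apply: rv_rec_indep => //; first exact: ltnW.
  by move=> i; case: ifP.
rewrite fubini_tonelli1//.
rewrite ge0_integral_distribution//; last 2 first.
  exact: measurable_fun_fubini_tonelli_F.
  by move=> z; apply: integral_ge0.
apply: eq_integral => w _; rewrite /fubini_F/=.
apply: ge0_integral_density => //; last exact: measurableT_comp.
by move=> A mA; have := Xrho (Ordinal kn) A mA; rewrite -rv_atE.
Qed.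

End independent_recursion.

(** * The one-step integral *)
Section fold.
Context {R : realType}.
Notation mu := (@lebesgue_measure R).
Notation mR := (measurableTypeR R).
Local Open Scope ereal_scope.

(** Folding the line at 0: only the even part [r u + r (- u)] matters, as a function
of [u ^ 2]. *)
Lemma ge0_integral_fold (r f : mR -> \bar R) :
  measurable_fun [set: mR] r -> (forall u, 0 <= r u) ->
  measurable_fun [set: mR] f -> (forall v, 0 <= f v) ->
  (forall u, (0 < u)%R -> r u + r (- u)%R = f (u ^+ 2)%R * (2 * u)%:E) ->
  \int[mu]_u r u = \int[mu]_v (f v * ((0 < v)%R%:R)%:E).
Proof.
move=> mr r0 mf f0 rf.
have mrN : measurable_fun [set: mR] (fun u : mR => r (- u)%R).
  by apply: (measurableT_comp mr); exact: oppr_measurable.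
rewrite ge0_integral_square//.
rewrite [in LHS](_ : [set: mR] = `]-oo, 0%R]%classic `|` `]0%R, +oo[%classic); last first.
  by rewrite -setCitvr setvU.
rewrite ge0_integral_setU//; last 2 first.
  - by rewrite -setCitvr setvU.
  - rewrite disj_set2E; apply/eqP; rewrite -subset0 => x []/= /[!in_itv]/=.
    by rewrite leNgt andbT => /negP.
transitivity (\int[mu]_(u in `]0%R, +oo[) (r (- u)%R + r u)).
  rewrite ge0_integralD//; last 2 first.
    exact: measurable_funTS.
    exact: measurable_funTS.
  congr (_ + _).
  transitivity (\int[mu]_(u in `]-oo, 0%R]) r (- - u)%R).
    by apply: eq_integral => u _; rewrite opprK.
  rewrite -(@ge0_integration_by_substitution0 _ (fun u => r (- u)%R))//.
  by rewrite integral_itv_obnd_cbnd//; exact: measurable_funTS.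
rewrite integral_mkcond; apply: eq_integral => u _ /=.
rewrite /patch mem_setE in_itv/= andbT; case: ifPn => u0; last by rewrite mul0r mule0.
by rewrite mul1r addeC rf.
Qed.

(** Coefficients of any sign: the shape coefficients need not be positive. *)
Lemma integral_lincomb (I : Type) (s : seq I) (c : I -> R) (f : I -> mR -> R) (V : I -> R) :
  (forall i, measurable_fun [set: mR] (f i)) -> (forall i x, (0 <= f i x)%R) ->
  (forall i, \int[mu]_x (f i x)%:E = (V i)%:E) ->
  \int[mu]_x (\sum_(i <- s) c i * f i x)%:E = (\sum_(i <- s) c i * V i)%:E.
Proof.
move=> mf f0 fV.
have fi i : mu.-integrable [set: mR] (EFin \o f i).
  apply/integrableP; split; first exact/measurable_EFinP.
  under eq_integral => x _ do rewrite /= ger0_norm ?f0//.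
  by rewrite fV ltry.
have cfi i : mu.-integrable [set: mR] (fun x => (c i)%:E * (f i x)%:E).
  by apply: (integrableZl measurableT (c i) (fi i)).
elim: s => [|i s IH].
  by rewrite big_nil; apply: integral0_eq => x _; rewrite big_nil.
rewrite big_cons EFinD -IH.
under eq_integral do rewrite big_cons EFinD EFinM.
rewrite integralD//; last first.
  rewrite (_ : (fun _ => _) = (fun x => \sum_(j <- s) ((c j)%:E * (f j x)%:E))); last first.
    by apply/funext => x; rewrite -sumEFin; apply: eq_bigr.
  exact: integrable_sum.
have -> : \int[mu]_x ((c i)%:E * (f i x)%:E) = (c i * V i)%:E.
  by rewrite EFinM -fV -(integralZl measurableT (fi i)).
by [].
Qed.

End fold.

Section scaled_convolution.
Context {R : realType}.
Notation mu := (@lebesgue_measure R).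
Notation mR := (measurableTypeR R).
Local Open Scope ereal_scope.

Lemma measurable_phi_affine (r : nat) (w kap : R) :
  measurable_fun [set: mR] ((fun v => phi r (w - kap * v)%R) : mR -> R).
Proof.
apply: (measurableT_comp (measurable_phi r)).
by apply: measurable_funB => //; exact: measurable_funM.
Qed.

Lemma hpow_phi_conv (q r : nat) (w kap : R) : (0 < q)%N -> (0 < r)%N -> (0 < kap)%R ->
  \int[mu]_v (hpow q v * phi r (w - kap * v))%:E =
  (Num.sqrt kap ^- q * hgamma q * phi (q + r) w)%:E.
Proof.
move=> q0 r0 k0.
have g0 : (0 < hgamma q :> R)%R by exact: hgamma_gt0.
have gN : (hgamma q != 0 :> R)%R by rewrite gt_eqF.
have kN : (kap != 0 :> R)%R by rewrite gt_eqF.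
have sN : (Num.sqrt kap ^+ q != 0)%R by rewrite expf_neq0// gt_eqF ?sqrtr_gt0.
pose f (y : mR) := (phi q y * phi r (w - y))%R.
have mf : measurable_fun [set: mR] (EFin \o f).
  apply/measurable_EFinP/measurable_funM; first exact: measurable_phi.
  apply: (measurableT_comp (measurable_phi r)); exact: measurable_funB.
have f0 y : 0 <= (EFin \o f) y by rewrite lee_fin mulr_ge0 ?phi_ge0.
have := ge0_integral_scaling k0 mf f0.
rewrite /= /f phi_conv// => H.
pose C := (Num.sqrt kap ^- q * hgamma q * kap)%R.
have C0 : (0 <= C)%R.
  by rewrite !mulr_ge0 ?invr_ge0 ?exprn_ge0 ?sqrtr_ge0 ?ltW.
transitivity (C%:E * \int[mu]_v (phi q (kap * v) * phi r (w - kap * v))%:E).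
  rewrite -ge0_integralZl_EFin; last 4 first.
  - exact: measurableT.
  - by move=> v _; rewrite lee_fin mulr_ge0 ?phi_ge0.
  - apply: (measurableT_comp mf); exact: measurable_funM.
  - exact: C0.
  apply: eq_integral => v _; rewrite -EFinM phiZ; last exact: k0.
  rewrite /C; congr EFin.
  move: (phi r _) => y; rewrite /phi.
  by field; rewrite gN kN sN.
rewrite H -!EFinM /C; congr EFin.
by field; rewrite ?gN ?kN ?sN.
Qed.

End scaled_convolution.

Section shape_density.
Context {R : realType}.
Notation mu := (@lebesgue_measure R).
Notation mR := (measurableTypeR R).
Variables a N : nat.
Implicit Types (s u w : R) (k i j : nat).

Lemma step_poly_homog c b s u : 0 < s ->
  (s / c.+1%:R + u) ^+ a * (s * (c%:R / c.+1%:R) - u) ^+ b =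
  \sum_(l < (a + b).+1) (step_poly c a b)`_l * s ^+ (a + b - l) * u ^+ l.
Proof.
move=> s0; have sN : s != 0 by rewrite gt_eqF.
have sz : (size (step_poly c a b : {poly R}) <= (a + b).+1)%N.
  by apply/leq_sizeP => l; exact: coef_step_poly_eq0.
transitivity (s ^+ (a + b) * (step_poly c a b).[u / s]).
  rewrite /step_poly hornerM !horner_exp !(hornerD, hornerN, hornerC, hornerX) exprD mulrACA -!exprMn.
  by congr (_ ^+ _ * _ ^+ _); field; rewrite ?sN ?natr1 ?nat1r pnatr_eq0.
rewrite (horner_coef_wide _ sz) mulr_sumr; apply: eq_bigr => -[l /= lab] _.
rewrite exprMn exprVn -{1}(@subnK l (a + b))// exprD.
by field; rewrite expf_neq0.
Qed.

(** The odd powers of [u] cancel between [u] and [- u]. *)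
Lemma step_poly_even c b s u : 0 < s -> (a + b <= (2 * N).+1)%N ->
  let g u := (s / c.+1%:R + u) ^+ a * (s * (c%:R / c.+1%:R) - u) ^+ b in
  g u + g (- u) =
  2 * \sum_(i < N.+1) (step_poly c a b)`_(2 * i) * s ^+ (a + b - 2 * i) * u ^+ (2 * i).
Proof.
move=> s0 abN g; rewrite /g !step_poly_homog// -big_split/=.
rewrite (sum_evens_trunc (F := fun l => (step_poly c a b)`_l * s ^+ (a + b - l) * u ^+ l +
  (step_poly c a b)`_l * s ^+ (a + b - l) * (- u) ^+ l) (H := N.+1)).
- rewrite mulr_sumr; apply: eq_bigr => i _.
  by rewrite (exprM (- u)) sqrrN -exprM; ring.
- by move=> l ol; rewrite exprNn -signr_odd ol expr1 mulN1r mulrN subrr.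
- by move=> l lab; rewrite coef_step_poly_eq0// !mul0r addr0.
- by move=> h hN; rewrite coef_step_poly_eq0 ?mul0r ?addr0//; lia.
Qed.

(** The density, without its exponential factor, of the sum [s] and the dispersion
[w] of [k.+1] variables, as given by the recursion.  The sum is cut at a common
bound [N], beyond which the coefficients vanish. *)
Definition shape_density k s w : R := \sum_(j < N.+1)
  shape_coef a k j * s ^+ (a * k.+1 - 2 * j) * phi (k + 2 * j) w.

(** The integrand, in the variable [u], of the passage from [k.+1] to [k.+2]
variables at the point [(s, w)]. *)
Definition step_integrand k s w u : R :=
  (s / k.+2%:R + u) ^+ a *
  shape_density k (s * (k.+1%:R / k.+2%:R) - u) (w - k.+2%:R / k.+1%:R * u ^+ 2).

(** After folding, the power [u ^ (2 * i)] has become the kernel of order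
[i + 1 / 2], and each term is a convolution of kernels; collecting the terms of
equal total order is the recursion defining [shape_coef]. *)
Lemma integral_step_integrand k s w : (0 < k)%N -> (a * k.+2 <= (2 * N).+1)%N -> 0 < s ->
  (forall u, 0 <= step_integrand k s w u) ->
  measurable_fun [set: mR] (step_integrand k s w : mR -> R) ->
  (\int[mu]_u (step_integrand k s w u)%:E = (shape_density k.+1 s w)%:E)%E.
Proof.
move=> k0 kN s0 r0 mr.
set c := k.+1; pose kap : R := c.+1%:R / c%:R.
have kap0 : 0 < kap by rewrite divr_gt0.
pose b j := (a * c - 2 * j)%N.
pose A (z : 'I_N.+1 * 'I_N.+1) : R := shape_coef a k z.1 *
  (step_poly c a (b z.1))`_(2 * z.2) * s ^+ (a + b z.1 - 2 * z.2).
pose B (z : 'I_N.+1 * 'I_N.+1) (v : mR) : R :=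
  hpow (2 * z.2).+1 v * phi (k + 2 * z.1) (w - kap * v).
have kj j : (0 < k + 2 * j)%N by rewrite addn_gt0 k0.
have mB z : measurable_fun [set: mR] (B z).
  apply: measurable_funM; first exact: measurable_hpow.
  exact: measurable_phi_affine.
have B0 z v : 0 <= B z v by rewrite mulr_ge0 ?hpow_ge0 ?phi_ge0.
pose f (v : mR) : R := \sum_z A z * B z v.
have rf u : 0 < u -> step_integrand k s w u + step_integrand k s w (- u) = f (u ^+ 2) * (2 * u).
  move=> u0; rewrite /step_integrand /shape_density sqrrN !mulr_sumr -big_split/=.
  rewrite /f -(pair_bigA _ (fun i j : 'I_N.+1 => A (i, j) * B (i, j) (u ^+ 2)))/= mulr_suml.
  apply: eq_bigr => j _.
  have [aj|aj] := ltnP (a * c) (2 * j).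
    rewrite shape_coef_eq0// !mul0r !mulr0 addr0 big1 ?mul0r// => i _.
    by rewrite /A/= shape_coef_eq0// !mul0r.
  have bj : (a + b j <= (2 * N).+1)%N by rewrite /b; move: kN; rewrite /c; nia.
  have := step_poly_even c (b := b j) u s0 bj; rewrite /= -/c => H.
  transitivity (shape_coef a k j * phi (k + 2 * j) (w - kap * u ^+ 2) *
    ((s / c.+1%:R + u) ^+ a * (s * (c%:R / c.+1%:R) - u) ^+ b j +
     (s / c.+1%:R - u) ^+ a * (s * (c%:R / c.+1%:R) - - u) ^+ b j)).
    by rewrite /b /kap; ring.
  rewrite H mulrCA !mulr_sumr mulr_suml; apply: eq_bigr => i _.
  rewrite /A /B/= hpow_sqr// (exprS u (2 * i)); field.
  by rewrite gt_eqF.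
have mf : measurable_fun [set: mR] f.
  by apply: measurable_sum => z; exact: measurable_funM.
have f0 v : 0 <= f v.
  have [v0|v0] := ltP 0 v; last first.
    by rewrite /f big1// => z _; rewrite /B hpow_le0// mul0r mulr0.
  have sv : 0 < Num.sqrt v by rewrite sqrtr_gt0.
  have := rf _ sv; rewrite (sqr_sqrtr (ltW v0)) => e.
  have sv2 : 0 < 2 * Num.sqrt v by rewrite mulr_gt0.
  rewrite -(pmulr_lge0 _ sv2) -e.
  by rewrite addr_ge0.
transitivity (\int[mu]_v ((f v)%:E * ((0 < v)%R%:R)%:E))%E.
  apply: (ge0_integral_fold (r := EFin \o step_integrand k s w) (f := EFin \o f)).
  - exact/measurable_EFinP.
  - by move=> u; rewrite lee_fin.
  - exact/measurable_EFinP.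
  - by move=> u; rewrite lee_fin.
  - by move=> u u0 /=; rewrite -EFinD -EFinM rf.
transitivity (\int[mu]_v (f v)%:E)%E.
  apply: eq_integral => v _; rewrite -EFinM; have [v0|v0] := ltP 0 v; rewrite ?mulr1//.
  by rewrite mulr0 /f big1// => z _; rewrite /B hpow_le0// mul0r mulr0.
rewrite (@integral_lincomb _ _ _ A B (fun z => step_scale c ^- (2 * z.2).+1 *
    hgamma (2 * z.2).+1 * phi ((2 * z.2).+1 + (k + 2 * z.1)) w))//; last first.
  by move=> z; rewrite /B hpow_phi_conv.
congr EFin.
pose G i h := (step_poly c a (b i))`_(2 * h) *
  (step_scale c ^- (2 * h).+1 * hgamma (2 * h).+1) * shape_coef a k i *
  s ^+ (a * c.+1 - 2 * (i + h)) * phi (c + 2 * (i + h)) w.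
transitivity (\sum_(j < N.+1) \sum_(i < j.+1) G i (j - i)%N); last first.
  apply: eq_bigr => j _; rewrite [shape_coef _ _ _]/= !mulr_suml; apply: eq_bigr => -[i /= ij] _.
  by rewrite /G -/c subnKC.
rewrite sum_triangle.
rewrite -(pair_bigA _ (fun i j : 'I_N.+1 => A (i, j) * (step_scale c ^- (2 * j).+1 *
    hgamma (2 * j).+1 * phi ((2 * j).+1 + (k + 2 * i)) w)))/=.
apply: eq_bigr => -[i /= iN] _.
have [ai|ai] := ltnP (a * c) (2 * i).
  rewrite big1 => [|h _]; last by rewrite /A/= shape_coef_eq0// !mul0r.
  by rewrite big1// => h _; rewrite /G shape_coef_eq0// !(mulr0, mul0r).
rewrite [RHS](@sum_ord_widen _ (G i) (N.+1 - i) N.+1); [|lia|].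
  apply: eq_bigr => -[h /= hN] _; rewrite /A /G/=.
  have [ah|ah] := ltnP (a + b i) (2 * h).
    by rewrite coef_step_poly_eq0// !(mulr0, mul0r).
  have -> : (a + b i - 2 * h = a * c.+1 - 2 * (i + h))%N by rewrite /b in ah *; nia.
  have -> : ((2 * h).+1 + (k + 2 * i) = c + 2 * (i + h))%N by rewrite /c; lia.
  by ring.
move=> h hN; rewrite /G coef_step_poly_eq0 ?mul0r//.
by rewrite /b; move: kN; rewrite -/c; nia.
Qed.

End shape_density.

(** * Shearing a triple integral *)
Section tonelli_shift.
Context {R : realType}.
Notation mu := (@lebesgue_measure R).
Notation mR := (measurableTypeR R).
Local Open Scope ereal_scope.

Lemma measurable_integral_last d (S : measurableType d) (G : S -> mR -> \bar R) :
  measurable_fun [set: S * mR] (fun z => G z.1 z.2) ->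
  (forall s x, 0 <= G s x) ->
  measurable_fun [set: S] (fun s => \int[mu]_x G s x).
Proof.
move=> mG G0.
have H := @measurable_fun_fubini_tonelli_F _ _ _ _ R mu (fun z => G z.1 z.2) mG (fun z => G0 _ _).
exact: H.
Qed.

Lemma measurable_section d (S : measurableType d) (G : S -> mR -> \bar R) s :
  measurable_fun [set: S * mR] (fun z => G z.1 z.2) ->
  measurable_fun [set: mR] (G s).
Proof.
move=> mG; have mp : measurable_fun [set: mR] (fun x : mR => (s, x)).
  exact: measurable_fun_pair.
exact: (measurableT_comp mG mp).
Qed.

Variables (T : mR -> mR -> mR -> \bar R) (delta : mR -> mR -> mR).
Hypothesis mT : measurable_fun [set: mR * mR * mR] (fun z => T z.1.1 z.1.2 z.2).
Hypothesis T0 : forall s w x, 0 <= T s w x.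
Hypothesis mdelta : measurable_fun [set: mR * mR] (fun z => delta z.1 z.2).

Let mcomp d (S : measurableType d) (f g h : S -> mR) :
  measurable_fun [set: S] f -> measurable_fun [set: S] g ->
  measurable_fun [set: S] h ->
  measurable_fun [set: S] (fun z => T (f z) (g z) (h z)).
Proof.
move=> mf mg mh.
have mp : measurable_fun [set: S] (fun z => (f z, g z, h z)).
  by apply: measurable_fun_pair => //; exact: measurable_fun_pair.
exact: (measurableT_comp mT mp).
Qed.

(** The shear [(s, w, x) |-> (s + x, w + delta, x)] is a translation in one variable at a time. *)
Lemma tonelli_shift :
  \int[mu]_s \int[mu]_w \int[mu]_x T s w x =
  \int[mu]_s \int[mu]_w \int[mu]_x T (s - x)%R (w - delta s x)%R x.
Proof.
transitivity (\int[mu]_s \int[mu]_x \int[mu]_w T s w x).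
  apply: eq_integral => s _; apply: tonelli_line => //.
  exact: (@mcomp _ _ (fun=> s) fst snd).
transitivity (\int[mu]_x \int[mu]_s \int[mu]_w T s w x).
  apply: tonelli_line => [|s x]; last exact: integral_ge0.
  apply: (measurable_integral_last (S := (mR * mR)%type) (G := fun z w => T z.1 w z.2)) => //.
  apply: (@mcomp _ _ (fun z : mR * mR * mR => z.1.1) snd (fun z => z.1.2)) => //.
    exact: measurableT_comp.
  exact: measurableT_comp.
transitivity (\int[mu]_x \int[mu]_s \int[mu]_w T (s - x)%R w x).
  apply: eq_integral => x _.
  rewrite -(@ge0_integral_translation _ (fun s => \int[mu]_w T s w x) (- x)%R)//.
  - apply: (measurable_integral_last (S := mR) (G := fun s w => T s w x)) => //.
    exact: (@mcomp _ _ fst snd (fun=> x)).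
  - by move=> s; exact: integral_ge0.
transitivity (\int[mu]_s \int[mu]_x \int[mu]_w T (s - x)%R w x).
  symmetry; apply: tonelli_line => [|s x]; last exact: integral_ge0.
  apply: (measurable_integral_last (S := (mR * mR)%type)
    (G := fun z w => T (z.1 - z.2)%R w z.2)) => //.
  apply: (@mcomp _ _ (fun z : mR * mR * mR => z.1.1 - z.1.2)%R snd (fun z => z.1.2)) => //.
    by apply: measurable_funB; exact: measurableT_comp.
  exact: measurableT_comp.
apply: eq_integral => s _.
transitivity (\int[mu]_x \int[mu]_w T (s - x)%R (w - delta s x)%R x).
  apply: eq_integral => x _.
  rewrite -(@ge0_integral_translation _ (fun w => T (s - x)%R w x) (- delta s x)%R)//.
  exact: (@mcomp _ _ (fun=> (s - x)%R) id (fun=> x)).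
apply: tonelli_line => //.
apply: (@mcomp _ _ (fun z : mR * mR => s - z.1)%R (fun z => z.2 - delta s z.1)%R fst) => //.
  exact: measurable_funB.
apply: measurable_funB => //.
have mp : measurable_fun [set: mR * mR] (fun z : mR * mR => (s, z.1)).
  exact: measurable_fun_pair.
exact: (measurableT_comp mdelta mp).
Qed.

End tonelli_shift.

(** * The cone inscribed in the positive orthant *)
Lemma measurable_indr_le d (T : measurableType d) (R : realType) (f g : T -> R) :
  measurable_fun setT f -> measurable_fun setT g ->
  measurable_fun setT (fun x => (f x <= g x)%R%:R : R).
Proof.
move=> mf mg.
rewrite (_ : (fun _ => _) = \1_[set x | f x <= g x]); last first.
  by apply/funext => x; rewrite indicE mem_setE.
by apply: measurable_indic; rewrite -[X in measurable X]setTI; exact: measurable_fun_ler.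
Qed.

Section cone.
Context {R : realType}.
Notation mu := (@lebesgue_measure R).
Notation mR := (measurableTypeR R).
Implicit Types (s w x W : R) (c k : nat).

(** In terms of [s] and [w], the cone of vectors of R^c with positive sum whose
angle to the diagonal has tangent at most [(c - 1) ^ (- 1 / 2)]; it is the
largest such cone inside the positive orthant. *)
Definition cone c (z : mR * mR) : bool :=
  [&& 0 < z.1, 0 <= z.2 & c%:R * (c%:R - 1) * z.2 <= z.1 ^+ 2].

(** The sum and the dispersion of [c.+1] numbers from those of the first [c] and the
last one; for [c = 0] the division by 0 gives the expected dispersion 0. *)
Definition update c (z : (mR * mR) * mR) : mR * mR :=
  (z.1.1 + z.2, z.1.2 + (c%:R * z.2 - z.1.1) ^+ 2 / (c%:R * (c%:R + 1))).

Lemma measurable_update c : measurable_fun setT (update c).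
Proof.
have m1 : measurable_fun setT (fun z : (mR * mR) * mR => z.1.1) by exact: measurableT_comp.
have m2 : measurable_fun setT (fun z : (mR * mR) * mR => z.1.2) by exact: measurableT_comp.
apply: measurable_fun_pair; first exact: measurable_funD.
apply: measurable_funD => //; apply: measurable_funM => //.
apply: measurable_funX; apply: measurable_funB => //.
exact: measurable_funM.
Qed.

Lemma measurable_cone c : measurable_fun setT (fun z => (cone c z)%:R : R).
Proof.
rewrite (_ : (fun _ => _) = fun z : mR * mR => (0 < z.1)%R%:R * ((0 <= z.2)%R%:R *
  (c%:R * (c%:R - 1) * z.2 <= z.1 ^+ 2)%R%:R)); last first.
  by apply/funext => z; rewrite /cone -!mulnb !natrM.
apply: measurable_funM; first exact: measurable_indr_lt.
apply: measurable_funM; first exact: measurable_indr_le.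
by apply: measurable_indr_le; [exact: measurable_funM|exact: measurable_funX].
Qed.

(** The membership inequality for [c.+1] variables, simplified; the lemmas on signs
below follow from it. *)
Lemma cone_update_le c s w x : (0 < c)%N -> cone c.+1 (update c ((s, w), x)) ->
  c%:R * w + (c%:R - 1) * x ^+ 2 <= 2 * s * x.
Proof.
move=> c0 /and3P[/= _ _]; have cR : 0 < c%:R :> R by rewrite ltr0n.
have c1 : 0 < c%:R + 1 :> R by rewrite addr_gt0.
rewrite -natr1 addrK => H.
have {}H : (c%:R + 1) * (c%:R * w + (c%:R - 1) * x ^+ 2 - 2 * s * x) <= 0.
  rewrite -subr_le0 in H; apply: le_trans H; rewrite le_eqVlt; apply/orP; left; apply/eqP.
  by field; rewrite !gt_eqF.
by rewrite pmulr_rle0// subr_le0 in H.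
Qed.

Lemma cone_update_gt0 c s w x : (0 < c)%N -> 0 < w -> cone c.+1 (update c ((s, w), x)) ->
  0 < s /\ 0 < x.
Proof.
move=> c0 w0 H; have := cone_update_le c0 H; case/and3P: H => /= sx _ _ le.
have cR : 1 <= c%:R :> R by rewrite ler1n.
have : 0 < s * x.
  have := mulr_gt0 (lt_le_trans ltr01 cR) w0.
  have := mulr_ge0 (_ : 0 <= c%:R - 1 :> R) (sqr_ge0 x); rewrite subr_ge0 => /(_ cR).
  by lra.
by case: (ltP 0 x) => x0; [rewrite pmulr_lgt0//|move=> sx0; exfalso; nra].
Qed.

Lemma cone_update_sum_gt0 c s w x : (1 < c)%N -> 0 <= w -> 0 <= x ->
  cone c.+1 (update c ((s, w), x)) -> 0 < s.
Proof.
move=> c1 w0 x0 H; have := cone_update_le (ltnW c1) H; case/and3P: H => /= sx _ _ le.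
have cR : 2 <= c%:R :> R by rewrite (ler_nat _ 2).
rewrite ltNge; apply/negP => s0.
have xp : 0 < x by lra.
by nra.
Qed.

(** Forgetting a coordinate maps the cone into the cone: the inequality
[cone_update_le] and [(s - (c - 1) x) ^ 2 >= 0] add up to the conclusion. *)
Lemma cone_update c s w x : (0 < c)%N -> 0 < s -> 0 <= w ->
  cone c.+1 (update c ((s, w), x)) -> cone c (s, w).
Proof.
move=> c0 s0 w0 H; have le := cone_update_le c0 H.
rewrite /cone/= s0 w0/=.
have cR : 1 <= c%:R :> R by rewrite ler1n.
have := sqr_ge0 (s - (c%:R - 1) * x).
by nra.
Qed.

End cone.

Section cone_density.
Context {R : realType}.
Notation mu := (@lebesgue_measure R).
Notation mR := (measurableTypeR R).
Variables a N : nat.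
Implicit Types (s u w x W : R) (c k : nat).

Notation shape_density := (@shape_density R a N).

Definition cone_density k s w : R := (cone k.+1 (s, w))%:R * shape_density k s w.

Lemma measurable_shape_density k :
  measurable_fun [set: mR * mR] (fun z => shape_density k z.1 z.2).
Proof.
apply: measurable_sum => j; apply: measurable_funM.
  by apply: measurable_funM => //; apply: measurable_funX; exact: measurable_fst.
by apply: (measurableT_comp (measurable_phi _)).
Qed.

Lemma measurable_cone_density k :
  measurable_fun [set: mR * mR] (fun z => cone_density k z.1 z.2).
Proof.
apply: measurable_funM; last exact: measurable_shape_density.
rewrite (_ : (fun _ => _) = fun z : mR * mR => (cone k.+1 z)%:R); last first.
  by apply/funext => -[].
exact: measurable_cone.
Qed.

Lemma shape_density_le0 k s w : w <= 0 -> shape_density k s w = 0.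
Proof. by move=> w0; rewrite /shape_density big1// => j _; rewrite phi_le0// mulr0. Qed.

Lemma cone_density_le0 k s w : w <= 0 -> cone_density k s w = 0.
Proof. by move=> w0; rewrite /cone_density shape_density_le0// mulr0. Qed.

(** For two variables the dispersion is [2 u ^ 2], where [s / 2 + u] and [s / 2 - u]
are the variables themselves; no convolution occurs, but the recursion gives
the right density. *)
Lemma shape_density_two s u : 0 < s -> 0 < u -> (a * 2 <= (2 * N).+1)%N ->
  (s / 2 + u) ^+ a * (s / 2 - u) ^+ a = shape_density 1 s (2 * u ^+ 2) * (2 * u).
Proof.
move=> s0 u0 aN.
have sh j : shape_coef a 1 j = (step_poly 1 a a)`_(2 * j) *
    (Num.sqrt 2 ^- (2 * j).+1 * hgamma (2 * j).+1) :> R.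
  rewrite [shape_coef _ _ _]/= big_ord_recl big1 ?addr0/=; last by move=> i _; rewrite mulr0.
  by rewrite mulr1 muln1 !subn0 /step_scale divr1.
have aa : (a + a <= (2 * N).+1)%N by lia.
have := @step_poly_even R a N 1 a s u s0 aa; rewrite /= => H.
apply: (@mulfI _ 2) => //.
transitivity (2 * \sum_(i < N.+1) (step_poly 1 a a)`_(2 * i) * s ^+ (a + a - 2 * i) * u ^+ (2 * i)).
  rewrite -H opprK.
  have -> : s * (1 / 2) = s / 2 by field.
  by ring.
rewrite /shape_density mulr_suml; congr (2 * _); apply: eq_bigr => i _.
rewrite sh /phi hpowZ// hpow_sqr// (_ : 1 + 2 * i = (2 * i).+1)%N// muln2 addnn.
rewrite (exprS u (2 * i)).
have h0 : hgamma (2 * i).+1 != 0 :> R by rewrite gt_eqF ?hgamma_gt0.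
have s2 : Num.sqrt 2 ^+ (2 * i).+1 != 0 :> R by rewrite expf_neq0// gt_eqF// sqrtr_gt0.
by field; rewrite h0 s2 gt_eqF.
Qed.

(** The point of the recursion that leads to [(s, w)] when the last variable is [s / k.+2%:R + u]. *)
Lemma update_shift k s u w :
  update k.+1 ((s * (k.+1%:R / k.+2%:R) - u, w - k.+2%:R / k.+1%:R * u ^+ 2), s / k.+2%:R + u) =
  (s, w).
Proof.
have k1 : k%:R + 1 != 0 :> R by rewrite natr1 pnatr_eq0.
have k2 : k%:R + 1 + 1 != 0 :> R by rewrite !natr1 pnatr_eq0.
rewrite /update/= -!natr1; congr pair; first by field.
by field; rewrite k1 k2.
Qed.

(** Over a point of the cone, the last variable is nonnegative and the previous
statistics lie in the smaller cone, so inserting both conditions changes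
nothing. *)
Lemma step_integrandE k s w u : cone k.+2 (s, w) ->
  step_integrand a N k s w u = (s / k.+2%:R + u) ^+ a * (0 <= s / k.+2%:R + u)%R%:R *
    cone_density k (s * (k.+1%:R / k.+2%:R) - u) (w - k.+2%:R / k.+1%:R * u ^+ 2).
Proof.
rewrite -{1}(update_shift k s u w) /step_integrand => H.
have [W0|W0] := ltP 0 (w - k.+2%:R / k.+1%:R * u ^+ 2); last first.
  by rewrite shape_density_le0// cone_density_le0// !mulr0.
have [S0 x0] := cone_update_gt0 (ltn0Sn k) W0 H.
by rewrite /cone_density (cone_update _ _ (ltW W0) H)// mul1r ltW// mulr1.
Qed.

Lemma measurable_step_integrand k s w : measurable_fun [set: mR] (step_integrand a N k s w : mR -> R).
Proof.
apply: measurable_funM.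
  by apply: measurable_funX; exact: measurable_funD.
have mp : measurable_fun [set: mR] (fun u : mR =>
    (s * (k.+1%:R / k.+2%:R) - u, w - k.+2%:R / k.+1%:R * u ^+ 2) : mR * mR).
  apply: measurable_fun_pair; apply: measurable_funB => //.
  by apply: measurable_funM => //; exact: measurable_funX.
exact: (measurableT_comp (measurable_shape_density k) mp).
Qed.

(** The shape coefficients may be negative, but on the cone the density is an
integral of nonnegative terms. *)
Lemma cone_density_ge0 k s w : (0 < k)%N -> (a * k.+1 <= (2 * N).+1)%N ->
  0 <= cone_density k s w.
Proof.
elim: k s w => [//|[|k] IH] s w _ aN.
  rewrite /cone_density; case: (boolP (cone 2 (s, w))) => [H|_]; last by rewrite mul0r.
  rewrite mul1r; have [w0|w0] := ltP 0 w; last by rewrite shape_density_le0.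
  have /and3P[/= s0 _ sw] := H.
  pose u := Num.sqrt (w / 2); have u0 : 0 < u by rewrite sqrtr_gt0 divr_gt0.
  have u2 : u ^+ 2 = w / 2 by rewrite sqr_sqrtr// divr_ge0// ltW.
  have := shape_density_two s0 u0 aN; rewrite u2 mulrC (_ : 2 * (w / 2) = w); last by field.
  move=> e; rewrite -(pmulr_lge0 _ (_ : 0 < 2 * u)) ?mulr_gt0// -e.
  have us : u <= s / 2.
    rewrite -(ler_pXn2r (_ : 0 < 2)%N) ?nnegrE ?(ltW u0) ?divr_ge0 ?(ltW s0)//.
    have -> : (s / 2) ^+ 2 = s ^+ 2 / 4 by field.
    by rewrite u2; move: sw; lra.
  by rewrite mulr_ge0// exprn_ge0//; lra.
rewrite /cone_density; case: (boolP (cone k.+3 (s, w))) => [H|_]; last by rewrite mul0r.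
have aN' : (a * k.+2 <= (2 * N).+1)%N by apply: leq_trans aN; rewrite leq_mul2l leqnSn orbT.
have r0 u : 0 <= step_integrand a N k.+1 s w u.
  rewrite step_integrandE//; apply: mulr_ge0; last exact: IH.
  by have [x0|x0] := leP 0 (s / k.+3%:R + u); rewrite ?mulr0// mulr1 exprn_ge0.
rewrite mul1r -lee_fin -(integral_step_integrand (k := k.+1))//.
- by apply: integral_ge0 => u _; rewrite lee_fin.
- by case/and3P: H.
- exact: measurable_step_integrand.
Qed.

End cone_density.

(** * The law of the sum and the dispersion on the cone *)
Section law.
Context d (T : measurableType d) (R : realType) (P : probability T R).
Notation mu := (@lebesgue_measure R).
Notation mR := (measurableTypeR R).
Variables (n : nat) (X : 'I_n -> {RV P >-> R}).
Hypothesis hX : independent_RVs X.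
Variables (a N : nat) (C : R).
Hypothesis C0 : 0 <= C.

(** A version of the gamma density that is positive at 0 when [a = 0], so that the
closed cone is covered without exceptional points. *)
Definition weight (x : mR) : R := C * (x ^+ a * expR (- x) * (0 <= x)%R%:R).

Hypothesis hw : forall i (B : set mR), measurable B ->
  P (X i @^-1` B) = (\int[mu]_(x in B) (weight x)%:E)%E.

Lemma weight_ge0 x : 0 <= weight x.
Proof.
rewrite /weight; case: (leP 0 x) => x0; rewrite ?mulr0// mulr1.
by rewrite !mulr_ge0 ?exprn_ge0 ?expR_ge0.
Qed.

Lemma measurable_weight : measurable_fun [set: mR] weight.
Proof.
apply: measurable_funM => //; apply: measurable_funM; last exact: measurable_indr_le.
by apply: measurable_funM; [exact: measurable_funX|exact: measurable_expRN].
Qed.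

Definition stat : nat -> T -> mR * mR :=
  rv_rec X (S := (mR * mR)%type) (0, 0) (@update R).

Lemma stat_ge0 k w : 0 <= (stat k w).2.
Proof.
elim: k => [|k IH] //=; rewrite /update/= addr_ge0// divr_ge0 ?sqr_ge0//.
Qed.

Local Open Scope ereal_scope.

Lemma integral_stat k (Psi : (mR * mR) * mR -> \bar R) : (k < n)%N ->
  measurable_fun setT Psi -> (forall z, 0 <= Psi z) ->
  \int[P]_w Psi (stat k w, rv_at X k w) =
  \int[P]_w \int[mu]_x (Psi (stat k w, x) * (weight x)%:E).
Proof.
move=> kn mPsi Psi0.
exact: (ge0_integral_rv_rec hX (S := (mR * mR)%type) (0%R, 0%R) (@measurable_update R) kn measurable_weight weight_ge0 hw mPsi Psi0).
Qed.

Lemma integral_statS k (F : mR * mR -> \bar R) : (k < n)%N ->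
  measurable_fun setT F -> (forall z, 0 <= F z) ->
  \int[P]_w F (stat k.+1 w) =
  \int[P]_w \int[mu]_x (F (update k (stat k w, x)) * (weight x)%:E).
Proof.
move=> kn mF F0.
apply: (@integral_stat k (F \o @update R k) kn); last by move=> z; exact: F0.
exact: (measurableT_comp mF (@measurable_update R k)).
Qed.

Lemma measurable_step_integral k (F : mR * mR -> \bar R) :
  measurable_fun setT F -> (forall z, 0 <= F z) ->
  measurable_fun setT (fun z => \int[mu]_x (F (update k (z, x)) * (weight x)%:E)).
Proof.
move=> mF F0.
apply: (measurable_integral_last (S := (mR * mR)%type)
  (G := fun z x => F (update k (z, x)) * (weight x)%:E)); last first.
  by move=> z x; rewrite mule_ge0 ?lee_fin ?weight_ge0.
apply: emeasurable_funM.
  rewrite (_ : (fun _ => _) = F \o @update R k); last by apply/funext => -[].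
  exact: (measurableT_comp mF (@measurable_update R k)).
apply/measurable_EFinP; exact: (measurableT_comp measurable_weight).
Qed.

Lemma step_integral_ge0 k (F : mR * mR -> \bar R) z : (forall z, 0 <= F z) ->
  0 <= \int[mu]_x (F (update k (z, x)) * (weight x)%:E).
Proof. by move=> F0; apply: integral_ge0 => x _; rewrite mule_ge0 ?lee_fin ?weight_ge0. Qed.

Lemma integral_stat1 (F : mR * mR -> \bar R) : (0 < n)%N ->
  measurable_fun setT F -> (forall z, 0 <= F z) ->
  \int[P]_w F (stat 1 w) = \int[mu]_x (F (x, 0%R) * (weight x)%:E).
Proof.
move=> n0 mF F0; rewrite integral_statS//.
transitivity (\int[P]_w (cst (\int[mu]_x (F (x, 0%R) * (weight x)%:E)) w)).
  apply: eq_integral => w _ /=; apply: eq_integral => x _.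
  by rewrite /update/= !add0r mul0r subrr expr0n/= mul0r.
rewrite integral_cst//. by rewrite [X in _ * X]probability_setT mule1.
Qed.

(** On the cone, the law of the statistics of [k.+1] variables has the density
[C ^ k.+1 exp (- s) shape_density].  The statement is on test functions
supported in the cone, since outside it the boundary of the orthant is seen. *)
Definition cone_law k := forall F : mR * mR -> \bar R,
  measurable_fun setT F -> (forall z, 0 <= F z) ->
  (forall z, ~~ cone k.+1 z -> F z = 0) ->
  \int[P]_w F (stat k.+1 w) = (C ^+ k.+1)%:E *
    \int[mu]_s \int[mu]_w (F (s, w) * (expR (- s) * cone_density a N k s w)%:E).

Lemma tonelli_shift2 (G : mR -> mR -> \bar R) :
  measurable_fun [set: mR * mR] (fun z => G z.1 z.2) -> (forall s x, 0 <= G s x) ->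
  \int[mu]_s \int[mu]_x G s x = \int[mu]_s \int[mu]_x G (s - x)%R x.
Proof.
move=> mG G0; rewrite tonelli_line//.
transitivity (\int[mu]_x \int[mu]_s G (s - x)%R x).
  apply: eq_integral => x _.
  rewrite -(@ge0_integral_translation _ (fun s => G s x) (- x)%R)//.
  have mp : measurable_fun [set: mR] (fun s : mR => (s, x)) by exact: measurable_fun_pair.
  exact: (measurableT_comp mG mp).
symmetry; apply: tonelli_line => //.
have mp : measurable_fun [set: mR * mR] (fun z : mR * mR => (z.1 - z.2, z.2)%R : mR * mR).
  by apply: measurable_fun_pair => //; exact: measurable_funB.
exact: (measurableT_comp mG mp).
Qed.

Lemma measurable_cone_integrand k (F : mR * mR -> \bar R) : measurable_fun setT F ->
  measurable_fun [set: mR * mR]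
    (fun z => F (z.1, z.2) * (expR (- z.1) * cone_density a N k z.1 z.2)%:E).
Proof.
move=> mF; apply: emeasurable_funM.
  rewrite (_ : (fun _ => _) = F); last by apply/funext => -[].
  exact: mF.
apply/measurable_EFinP/measurable_funM.
  by apply: (measurableT_comp measurable_expRN).
exact: measurable_cone_density.
Qed.

(** The recursion starts with two variables: for one variable the dispersion is
concentrated at 0 and has no density. *)
Lemma cone_law_two : (1 < n)%N -> (a * 2 <= (2 * N).+1)%N -> cone_law 1.
Proof.
move=> n1 aN F mF F0 Fc.
rewrite integral_statS//.
rewrite (@integral_stat1 (fun z => \int[mu]_x (F (update 1 (z, x)) * (weight x)%:E))); last 3 first.
- exact: ltnW.
- exact: measurable_step_integral.
- by move=> z; exact: step_integral_ge0.
pose G (s x : mR) := F (s + x, (x - s) ^+ 2 / 2)%R * (weight x * weight s)%:E.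
have G0 s x : 0 <= G s x by rewrite mule_ge0// lee_fin mulr_ge0 ?weight_ge0.
have mG : measurable_fun [set: mR * mR] (fun z => G z.1 z.2).
  apply: emeasurable_funM.
    have mp : measurable_fun [set: mR * mR] (fun z : mR * mR =>
        (z.1 + z.2, (z.2 - z.1) ^+ 2 / 2)%R : mR * mR).
      apply: measurable_fun_pair; first exact: measurable_funD.
      by apply: measurable_funM => //; apply: measurable_funX; exact: measurable_funB.
    exact: (measurableT_comp mF mp).
  apply/measurable_EFinP/measurable_funM.
    by apply: (measurableT_comp measurable_weight).
  by apply: (measurableT_comp measurable_weight).
transitivity (\int[mu]_s \int[mu]_x G s x).
  apply: eq_integral => s _.
  rewrite muleC -ge0_integralZl_EFin; last 4 first.
  - exact: measurableT.
  - by move=> x _; rewrite mule_ge0 ?lee_fin ?weight_ge0.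
  - have mp : measurable_fun [set: mR] (fun x : mR => ((s, 0%R), x) : mR * mR * mR).
      exact: measurable_fun_pair.
    apply: emeasurable_funM; last by apply/measurable_EFinP; exact: measurable_weight.
    exact: (measurableT_comp mF (measurableT_comp (@measurable_update R 1) mp)).
  - exact: weight_ge0.
  apply: eq_integral => x _; rewrite muleC -muleA -EFinM /G /update/= add0r.
  by rewrite [in X in F (_, X)](_ : (1 * (1 + 1) = 2 :> R)%R) ?mul1r//; ring.
rewrite tonelli_shift2//.
have d0 s w : (0 <= cone_density a N 1 s w :> R)%R by exact: cone_density_ge0.
have mK := measurable_cone_integrand 1 mF.
have K0 s w : 0 <= F (s, w) * (expR (- s) * cone_density a N 1 s w)%:E.
  apply: mule_ge0; first exact: F0.
  by rewrite lee_fin; apply: mulr_ge0; [exact: expR_ge0|exact: d0].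
have mKs s : measurable_fun [set: mR]
    (fun w => F (s, w) * (expR (- s) * cone_density a N 1 s w)%:E).
  exact: (measurable_section (S := mR) (G := fun s w =>
    F (s, w) * (expR (- s) * cone_density a N 1 s w)%:E) s mK).
have H s : \int[mu]_x G (s - x)%R x =
    (C ^+ 2)%:E * \int[mu]_w (F (s, w) * (expR (- s) * cone_density a N 1 s w)%:E).
  pose r (u : mR) := F (s, 2 * u ^+ 2)%R * (weight (s / 2 + u)%R * weight (s / 2 - u)%R)%:E.
  have r0 u : 0 <= r u.
    apply: mule_ge0; first exact: F0.
    by rewrite lee_fin; apply: mulr_ge0; exact: weight_ge0.
  have mr : measurable_fun [set: mR] r.
    apply: emeasurable_funM.
      have mp : measurable_fun [set: mR] (fun u : mR => (s, 2 * u ^+ 2)%R : mR * mR).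
        apply: measurable_fun_pair => //; apply: measurable_funM => //; exact: measurable_funX.
      exact: (measurableT_comp mF mp).
    apply/measurable_EFinP/measurable_funM.
      apply: (measurableT_comp measurable_weight); exact: measurable_funD.
    by apply: (measurableT_comp measurable_weight); exact: measurable_funB.
  pose h (w : mR) := (2 * C ^+ 2)%:E * (F (s, w) * (expR (- s) * cone_density a N 1 s w)%:E).
  have C20 : (0 <= 2 * C ^+ 2)%R by rewrite mulr_ge0// exprn_ge0.
  have h0 w : 0 <= h w by apply: mule_ge0; [rewrite lee_fin|exact: K0].
  have mh : measurable_fun [set: mR] h by exact: measurable_funeM.
  have mh2 : measurable_fun [set: mR] (fun v : mR => h (2 * v)%R).
    by apply: (measurableT_comp mh); exact: measurable_funM.
  transitivity (\int[mu]_u r u).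
    have mG2 : measurable_fun [set: mR] (fun x => G (s - x)%R x).
      have mp : measurable_fun [set: mR] (fun x : mR => (s - x, x)%R : mR * mR).
        by apply: measurable_fun_pair => //; exact: measurable_funB.
      exact: (measurableT_comp mG mp).
    transitivity (\int[mu]_u (fun x => G (s - x)%R x) (u + s / 2)%R).
      exact/esym/(ge0_integral_translation (s / 2)%R mG2 (fun x => G0 _ _)).
    apply: eq_integral => u _; rewrite /G /r.
    have -> : (s - (u + s / 2) = s / 2 - u)%R by field.
    have -> : (s / 2 - u + (u + s / 2) = s)%R by field.
    have -> : ((u + s / 2 - (s / 2 - u)) ^+ 2 / 2 = 2 * u ^+ 2)%R by field.
    by rewrite (addrC u).
  transitivity (\int[mu]_v (h (2 * v)%R * ((0 < v)%R%:R)%:E)).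
    apply: (ge0_integral_fold mr r0 mh2 (fun v => h0 _)) => u u0.
    rewrite /r /h sqrrN opprK (mulrC (weight (s / 2 - u)%R)) -ge0_muleDr; last 2 first.
    - by rewrite lee_fin; apply: mulr_ge0; exact: weight_ge0.
    - by rewrite lee_fin; apply: mulr_ge0; exact: weight_ge0.
    case: (boolP (cone 2 (s, 2 * u ^+ 2)%R)) => [cz|nc]; last by rewrite Fc// !mul0e mule0 mul0e.
    have /and3P[/= s0 _ su] := cz.
    have us : (u <= s / 2)%R.
      rewrite -(ler_pXn2r (_ : 0 < 2)%N) ?nnegrE ?(ltW u0) ?divr_ge0 ?(ltW s0)//.
      have -> : ((s / 2) ^+ 2 = s ^+ 2 / 4)%R by field.
      by move: su; lra.
    rewrite /cone_density cz mul1r muleCA -muleA -!EFinM -?EFinD; congr (_ * _%:E).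
    rewrite /weight.
    have -> : (0 <= s / 2 + u)%R by lra.
    have -> : (0 <= s / 2 - u)%R by lra.
    have -> : (expR (- s) = expR (- (s / 2 + u)) * expR (- (s / 2 - u)))%R.
      by rewrite -expRD; congr expR; field.
    have e := shape_density_two s0 u0 aN.
    transitivity (2 * C ^+ 2 * (expR (- (s / 2 + u)) * expR (- (s / 2 - u))) *
      ((s / 2 + u) ^+ a * (s / 2 - u) ^+ a))%R; first by rewrite /=; ring.
    by rewrite e; ring.
  transitivity (\int[mu]_v h (2 * v)%R).
    apply: eq_integral => v _; case: ltP => v0; rewrite ?mule1// mule0 /h.
    rewrite cone_density_le0 ?mulr0 ?mule0//; lra.
  have two0 : (0 < 2 :> R)%R by [].
  rewrite (ge0_integral_scaling two0 mh h0) /h.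
  rewrite ge0_integralZl_EFin; [|exact: measurableT|by move=> w _; exact: K0|exact: mKs|exact: C20].
  by rewrite muleA -EFinM; congr (_%:E * _); field.
transitivity (\int[mu]_s ((C ^+ 2)%:E * \int[mu]_w
    (F (s, w) * (expR (- s) * cone_density a N 1 s w)%:E))).
  by apply: eq_integral => s _; exact: H.
rewrite ge0_integralZl_EFin; [by []|exact: measurableT| | |by rewrite exprn_ge0].
- by move=> s _; apply: integral_ge0 => w _; exact: K0.
- exact: (measurable_integral_last (S := mR) (G := fun s w =>
    F (s, w) * (expR (- s) * cone_density a N 1 s w)%:E) mK K0).
Qed.

Lemma cone_law_succ k : (0 < k)%N -> (k.+1 < n)%N -> (a * k.+2 <= (2 * N).+1)%N ->
  cone_law k -> cone_law k.+1.
Proof.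
move=> k0 kn aN IH F mF F0 Fc.
have aN' : (a * k.+1 <= (2 * N).+1)%N by apply: leq_trans aN; rewrite leq_mul2l leqnSn orbT.
have d0 s w : (0 <= cone_density a N k s w :> R)%R by exact: cone_density_ge0.
rewrite (integral_statS kn mF F0).
(* the dispersion is nonnegative; recording it makes [H] vanish off the smaller cone *)
pose H z := ((0 <= z.2)%R%:R)%:E * \int[mu]_x (F (update k.+1 (z, x)) * (weight x)%:E).
transitivity (\int[P]_w H (stat k.+1 w)).
  by apply: eq_integral => w _; rewrite /H stat_ge0 mul1e.
have mH : measurable_fun setT H.
  apply: emeasurable_funM; last exact: measurable_step_integral.
  by apply/measurable_EFinP; exact: measurable_indr_le.
have H0 z : 0 <= H z by rewrite mule_ge0 ?lee_fin//; exact: step_integral_ge0.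
have Hc z : ~~ cone k.+1 z -> H z = 0.
  case: z => s w ncone; rewrite /H/=; case: leP => w0; last by rewrite mul0e.
  rewrite mul1e; apply: integral0_eq => x _; rewrite /weight; case: leP => x0; last by rewrite !mulr0 mule0.
  rewrite Fc ?mul0e//; apply: contra ncone => cz.
  exact: (cone_update (ltn0Sn k) (cone_update_sum_gt0 _ w0 x0 cz) w0 cz).
rewrite (IH H mH H0 Hc); clear IH.
pose c : R := k.+1%:R.
pose J s w x := F (update k.+1 ((s, w), x)) *
  (weight x * (expR (- s) * cone_density a N k s w))%:E.
have T0 s w x : 0 <= J s w x.
  apply: mule_ge0; first exact: F0.
  rewrite lee_fin; apply: mulr_ge0; first exact: weight_ge0.
  by apply: mulr_ge0; [exact: expR_ge0|exact: d0].
have mT : measurable_fun [set: mR * mR * mR] (fun z => J z.1.1 z.1.2 z.2).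
  apply: emeasurable_funM.
    rewrite (_ : (fun _ => _) = F \o @update R k.+1); last by apply/funext => -[[]].
    exact: (measurableT_comp mF (@measurable_update R k.+1)).
  apply/measurable_EFinP/measurable_funM.
    by apply: (measurableT_comp measurable_weight).
  apply: measurable_funM.
    apply: (measurableT_comp measurable_expRN); exact: measurableT_comp.
  by apply: (measurableT_comp (measurable_cone_density a N k)).
have mTx s w : measurable_fun [set: mR] (J s w).
  by apply: (measurable_section (S := (mR * mR)%type) (G := fun z x => J z.1 z.2 x) (s, w)).
have HT s w : H (s, w) * (expR (- s) * cone_density a N k s w)%:E = \int[mu]_x J s w x.
  rewrite /H/=; case: leP => w0; last first.
    rewrite mul0e mul0e; apply/esym/integral0_eq => x _.
    by rewrite /J cone_density_le0 ?ltW// !mulr0 mule0.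
  rewrite mul1e muleC -ge0_integralZl_EFin; last 4 first.
  - exact: measurableT.
  - by move=> x _; rewrite mule_ge0 ?lee_fin ?weight_ge0.
  - apply: emeasurable_funM; last by apply/measurable_EFinP; exact: measurable_weight.
    have mp : measurable_fun [set: mR] (fun x : mR => update k.+1 ((s, w), x)).
      have mq : measurable_fun [set: mR] (fun x : mR => ((s, w), x)) by exact: measurable_fun_pair.
      exact: (measurableT_comp (@measurable_update R k.+1) mq).
    exact: (measurableT_comp mF mp).
  - by apply: mulr_ge0; [exact: expR_ge0|exact: d0].
  by apply: eq_integral => x _; rewrite muleC -muleA -EFinM.
transitivity ((C ^+ k.+1)%:E * \int[mu]_s \int[mu]_w \int[mu]_x J s w x).
  by congr (_ * _); apply: eq_integral => s _; apply: eq_integral => w _; exact: HT.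
clear H mH H0 Hc HT.
(* the dispersion gained when [x] is added to [s - x] *)
pose del (s x : mR) : R := ((c * x - (s - x)) ^+ 2 / (c * (c + 1)))%R.
have mdel : measurable_fun [set: mR * mR] (fun z => del z.1 z.2).
  apply: measurable_funM => //; apply: measurable_funX; apply: measurable_funB.
    exact: measurable_funM.
  exact: measurable_funB.
rewrite (tonelli_shift mT T0 mdel).
have mK := measurable_cone_integrand k.+1 mF.
have d1 s w : (0 <= cone_density a N k.+1 s w :> R)%R by exact: cone_density_ge0.
have K0 s w : 0 <= F (s, w) * (expR (- s) * cone_density a N k.+1 s w)%:E.
  apply: mule_ge0; first exact: F0.
  by rewrite lee_fin; apply: mulr_ge0; [exact: expR_ge0|exact: d1].
have TK s w : \int[mu]_x J (s - x)%R (w - del s x)%R x =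
    C%:E * (F (s, w) * (expR (- s) * cone_density a N k.+1 s w)%:E).
  have updE x : update k.+1 (((s - x)%R, (w - del s x)%R), x) = (s, w).
    by rewrite /update/= -/c /del; congr pair; rewrite ?subrK.
  case: (boolP (cone k.+2 (s, w))) => [cz|ncone]; last first.
    rewrite (Fc _ ncone) mul0e mule0; apply: integral0_eq => x _.
    by rewrite /J updE (Fc _ ncone) mul0e.
  pose r x : R := (weight x * (expR (- (s - x)) * cone_density a N k (s - x) (w - del s x)))%R.
  have mr : measurable_fun [set: mR] (EFin \o r).
    apply/measurable_EFinP/measurable_funM; first exact: measurable_weight.
    have ms : measurable_fun [set: mR] (fun x : mR => s - x)%R by exact: measurable_funB.
    apply: measurable_funM; first exact: (measurableT_comp measurable_expRN ms).
    have mp : measurable_fun [set: mR] (fun x : mR => (s - x, w - del s x)%R : mR * mR).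
      apply: measurable_fun_pair => //; apply: measurable_funB => //.
      have mq : measurable_fun [set: mR] (fun x : mR => (s, x)) by exact: measurable_fun_pair.
      exact: (measurableT_comp mdel mq).
    exact: (measurableT_comp (measurable_cone_density a N k) mp).
  have r0 x : 0 <= (EFin \o r) x.
    rewrite lee_fin; apply: mulr_ge0; first exact: weight_ge0.
    by apply: mulr_ge0; [exact: expR_ge0|exact: d0].
  transitivity (F (s, w) * \int[mu]_x (r x)%:E).
    rewrite -ge0_integralZl; last 4 first.
    - exact: measurableT.
    - exact: mr.
    - by move=> x _; exact: r0.
    - exact: F0.
    by apply: eq_integral => x _; rewrite /J updE.
  rewrite muleCA; congr (_ * _).
  have s0 : (0 < s)%R by case/and3P: cz.
  have si0 u : (0 <= step_integrand a N k s w u)%R.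
    rewrite (step_integrandE _ _ _ cz); apply: mulr_ge0; last exact: d0.
    by case: (leP 0%R (s / k.+2%:R + u)%R) => x0; rewrite ?mulr0// mulr1 exprn_ge0.
  have msi := @measurable_step_integrand R a N k s w.
  transitivity (\int[mu]_u (r (u + s / k.+2%:R)%R)%:E).
    exact/esym/(ge0_integral_translation (s / k.+2%:R)%R mr r0).
  transitivity ((C * expR (- s))%:E * \int[mu]_u (step_integrand a N k s w u)%:E).
    rewrite -ge0_integralZl_EFin; last 4 first.
    - exact: measurableT.
    - by move=> u _; rewrite lee_fin.
    - exact/measurable_EFinP.
    - by rewrite mulr_ge0 ?expR_ge0.
    apply: eq_integral => u _; rewrite step_integrandE// -EFinM /r /weight; congr EFin.
    have k1 : (k%:R + 1 != 0 :> R)%R by rewrite natr1 pnatr_eq0.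
    have k2 : (k%:R + 1 + 1 != 0 :> R)%R by rewrite !natr1 pnatr_eq0.
    have e1 : (s - (u + s / k.+2%:R) = s * (k.+1%:R / k.+2%:R) - u)%R.
      by rewrite -!natr1; field.
    have e2 : (del s (u + s / k.+2%:R) = k.+2%:R / k.+1%:R * u ^+ 2)%R.
      by rewrite /del /c -!natr1; field; rewrite k1 k2.
    have e3 : (expR (- s) = expR (- (u + s / k.+2%:R)) * expR (- (s - (u + s / k.+2%:R))))%R.
      by rewrite -expRD; congr expR; ring.
    by rewrite e3 e2 e1 (addrC u); ring.
  rewrite integral_step_integrand// -!EFinM /cone_density cz mul1r; congr EFin.
  by rewrite mulrA.
transitivity ((C ^+ k.+1)%:E * \int[mu]_s \int[mu]_w
    (C%:E * (F (s, w) * (expR (- s) * cone_density a N k.+1 s w)%:E))).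
  by congr (_ * _); apply: eq_integral => s _; apply: eq_integral => w _; exact: TK.
rewrite [in RHS]exprSr EFinM -muleA; congr (_ * _).
rewrite -ge0_integralZl_EFin; last 4 first.
- exact: measurableT.
- by move=> s _; apply: integral_ge0 => w _; exact: K0.
- exact: (measurable_integral_last (S := mR) (G := fun s w =>
    F (s, w) * (expR (- s) * cone_density a N k.+1 s w)%:E) mK K0).
- exact: C0.
apply: eq_integral => s _.
rewrite ge0_integralZl_EFin; [by []|exact: measurableT|by move=> w _; exact: K0| |exact: C0].
exact: (measurable_section (S := mR) (G := fun s w =>
    F (s, w) * (expR (- s) * cone_density a N k.+1 s w)%:E) s mK).
Qed.

Lemma cone_law_stat k : (0 < k)%N -> (k < n)%N -> (a * k.+1 <= (2 * N).+1)%N -> cone_law k.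
Proof.
elim: k => [//|[|k] IH] _ kn aN; first exact: cone_law_two.
apply: cone_law_succ => //; apply: IH => //; first exact: ltnW.
by apply: leq_trans aN; rewrite leq_mul2l leqnSn orbT.
Qed.

End law.

(** * The angle as a function of the sum and the dispersion *)
Section geometry.
Context {R : realType}.

(** When the sum is not positive, the cosine is nonpositive, and so is the tangent
of an angle in [[0, pi]] with the convention that dividing by 0 gives 0. *)
Lemma tan_angle_ones_le n (x : 'I_n -> R) (t : R) : (0 < n)%N -> 0 <= t ->
  (tan (angle x (fun=> 1)) <= t) =
  (0 < \sum_i x i) ==> (n%:R * (\sum_i x i ^+ 2) <= (1 + t ^+ 2) * (\sum_i x i) ^+ 2).
Proof.
move=> n0 t0; rewrite /angle.
under eq_bigr do rewrite mulr1.
have -> : \sum_(i < n) (1 : R) ^+ 2 = n%:R.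
  by under eq_bigr do rewrite expr1n; rewrite sumr_const card_ord.
set S := \sum_i x i; set Q := \sum_i x i ^+ 2.
have nR0 : 0 < n%:R :> R by rewrite ltr0n.
have Q0 : 0 <= Q by apply: sumr_ge0 => i _; exact: sqr_ge0.
have CS : S ^+ 2 <= n%:R * Q.
  have : 0 <= \sum_i (n%:R * x i - S) ^+ 2.
    by apply: sumr_ge0 => i _; exact: sqr_ge0.
  have -> : \sum_i (n%:R * x i - S) ^+ 2 = n%:R * (n%:R * Q - S ^+ 2).
    transitivity (\sum_i (n%:R ^+ 2 * x i ^+ 2 +
        (- 2 * n%:R * S) * x i + S ^+ 2)).
      by apply: eq_bigr => i _; ring.
    rewrite !big_split /= -!mulr_sumr -/Q -/S sumr_const card_ord -mulr_natr.
    by ring.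
  by rewrite pmulr_rge0// subr_ge0.
set c := S / _.
have c2 : c ^+ 2 = S ^+ 2 / (Q * n%:R).
  by rewrite /c exprMn exprVn exprMn !sqr_sqrtr// ltW.
have c21 : c ^+ 2 <= 1.
  rewrite c2; have [Q1|Q1] := ltP 0 Q; last first.
    have -> : Q = 0 by apply/eqP; rewrite eq_le Q0 Q1.
    by rewrite mul0r invr0 mulr0.
  by rewrite ler_pdivrMr ?mulr_gt0// mul1r mulrC.
have cI : c \in `[-1, 1] by rewrite in_itv/= -ler_norml -(ler_pXn2r (_ : 0 < 2)%N) ?nnegrE// expr1n real_normK ?num_real.
rewrite /tan sin_acos ?acosK//.
have [S0|S0] := ltP 0 S; last first.
  rewrite implyFb; apply: le_trans t0; apply: mulr_ge0_le0; first exact: sqrtr_ge0.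
  by rewrite invr_le0 /c; apply: mulr_le0_ge0 => //; rewrite invr_ge0 mulr_ge0 ?sqrtr_ge0.
rewrite implyTb.
have Q1 : 0 < Q by have := exprn_gt0 2 S0; nra.
have c0 : 0 < c by rewrite divr_gt0// mulr_gt0// sqrtr_gt0.
rewrite ler_pdivrMr// -(ler_pXn2r (_ : 0 < 2)%N) ?nnegrE ?sqrtr_ge0 ?mulr_ge0 ?(ltW c0) ?(ltW S0)//.
rewrite sqr_sqrtr ?subr_ge0// lerBlDr.
have -> : (t * c) ^+ 2 + c ^+ 2 = (1 + t ^+ 2) * c ^+ 2 by ring.
by rewrite c2 mulrA ler_pdivlMr ?mulr_gt0// mul1r (mulrC Q).
Qed.

End geometry.
Section statistics.
Context d (T : measurableType d) (R : realType) (P : probability T R).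
Notation mu := (@lebesgue_measure R).
Notation mR := (measurableTypeR R).
Variables (n : nat) (X : 'I_n -> {RV P >-> R}).

Lemma stat_sums k w : stat X k w =
  (\sum_(i < k) rv_at X i w, \sum_(i < k) rv_at X i w ^+ 2 -
    (\sum_(i < k) rv_at X i w) ^+ 2 / k%:R) :> R * R.
Proof.
elim: k => [|[|k] IH]; first by rewrite !big_ord0 expr0n/= mul0r subrr.
  rewrite /stat/= /update/= !big_ord_recr !big_ord0/= !add0r mul0r subrr.
  by rewrite expr0n mul0r divr1 subrr.
rewrite (_ : stat X k.+2 w = update k.+1 (stat X k.+1 w, rv_at X k.+1 w))// IH /update/= ![\sum_(i < k.+2) _]big_ord_recr/=; congr pair.
move: (\sum_(i < k.+1) rv_at X i w) (\sum_(i < k.+1) rv_at X i w ^+ 2) (rv_at X k.+1 w) => S Q x.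
have k1 : k%:R + 1 != 0 :> R by rewrite natr1 pnatr_eq0.
have k2 : k%:R + 1 + 1 != 0 :> R by rewrite !natr1 pnatr_eq0.
by rewrite -!natr1; field; rewrite k1 k2.
Qed.

Lemma stat_sumsE w (S := \sum_i X i w) : stat X n w =
  (S, \sum_i X i w ^+ 2 - S ^+ 2 / n%:R) :> R * R.
Proof.
rewrite stat_sums.
have e i : rv_at X (i : 'I_n) w = X i w.
  by rewrite (rv_atE X (ltn_ord i)); congr (X _ w); apply: val_inj.
have -> : \sum_(i < n) rv_at X i w = S by apply: eq_bigr => i _; exact: e.
by congr (_, _ - _); apply: eq_bigr => i _; rewrite e.
Qed.

Lemma measurable_stat k : measurable_fun setT (stat X k).
Proof. exact: (measurable_rv_rec X (S := (mR * mR)%type) (0%R, 0%R) (@measurable_update R) k). Qed.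

End statistics.

Section radial.
Context {R : realType}.
Notation mu := (@lebesgue_measure R).
Notation mR := (measurableTypeR R).

Lemma integral_expR_pow q : (0 < q)%N ->
  (\int[mu]_s ((0 < s)%R%:R * (s ^+ q.-1 * expR (- s)))%:E = (gamma q%:R : R)%:E)%E.
Proof.
move=> q0; have q20 : (0 < 2 * q)%N by rewrite muln_gt0.
have -> : gamma q%:R = hgamma (2 * q) :> R.
  by rewrite /hgamma natrM; congr gamma; field.
rewrite -(egamma_hgamma q20); apply: eq_integral => s _; congr EFin.
rewrite /hpow; case: ltP => s0; last by rewrite !mul0r.
rewrite mul1r exprM sqr_sqrtr ?(ltW s0)// -{2}(prednK q0) exprS.
by field; rewrite gt_eqF.
Qed.

Lemma integral_phi_le q x : (0 < q)%N -> 0 <= x ->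
  (\int[mu]_y (phi q y * (y <= x)%R%:R)%:E =
   (2 / q%:R * Num.sqrt x ^+ q / hgamma q)%:E)%E.
Proof.
move=> q0 x0; have g0 := @hgamma_gt0 R q q0.
have mh : measurable_fun [set: mR] (EFin \o (phi q : mR -> R)).
  by apply/measurable_EFinP; exact: measurable_phi.
transitivity (\int[mu]_(y in `]-oo, x]) (phi q y)%:E)%E.
  rewrite [RHS]integral_mkcond; apply: eq_integral => y _.
  rewrite /patch mem_setE in_itv/=; case: (leP y x) => yx; rewrite ?mulr1// ?mulr0//.
rewrite -integral_itv_bndo_bndc; last exact: measurable_funTS.
transitivity (\int[mu]_y ((hgamma q)^-1%:E * (hpow q y * (y < x)%R%:R)%:E))%E.
  rewrite [LHS]integral_mkcond; apply: eq_integral => y _.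
  rewrite /patch mem_setE in_itv/= -EFinM /phi.
  by case: (ltP y x) => yx; rewrite ?mulr1 ?mulr0// mulrC.
rewrite ge0_integralZl_EFin; last 4 first.
- exact: measurableT.
- by move=> y _; rewrite lee_fin mulr_ge0 ?hpow_ge0.
- apply/measurable_EFinP/measurable_funM; first exact: measurable_hpow.
  exact: measurable_indr_lt.
- by rewrite invr_ge0 ltW.
by rewrite integral_hpow// -EFinM mulrC.
Qed.

End radial.

(** * The probability of a cap *)
Section cap_probability.
Context d (T : measurableType d) (R : realType) (P : probability T R).
Notation mu := (@lebesgue_measure R).
Notation mR := (measurableTypeR R).
Variables (alpha n : nat) (X : 'I_n -> {RV P >-> R}).
Hypotheses (halpha : (1 <= alpha)%N) (hn : (2 <= n)%N).
Hypothesis hX : independent_RVs X.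
Hypothesis hdens : forall i, has_density (X i) (gamma_pdf alpha).
Let a := (alpha - 1)%N.
Let N := poly_order alpha n.
Let C : R := (gamma alpha%:R)^-1.

Let gamma_alpha : gamma alpha%:R = hgamma (2 * alpha) :> R.
Proof. by rewrite /hgamma natrM; congr gamma; field. Qed.

Let C_gt0 : 0 < C.
Proof. by rewrite invr_gt0 gamma_alpha hgamma_gt0// muln_gt0. Qed.

Let C_ge0 : 0 <= C. Proof. exact: ltW. Qed.

Let gamma_pdf_weight x : x != 0 -> gamma_pdf alpha x = weight a C x.
Proof.
rewrite /gamma_pdf /weight => xN0; have [x0|x0|x0] := ltgtP 0 x.
- by rewrite mulr1 -/a -/C; ring.
- by rewrite !mulr0.
- by rewrite -x0 eqxx in xN0.
Qed.

Lemma prob_weight i (B : set mR) : measurable B ->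
  P (X i @^-1` B) = (\int[mu]_(x in B) (weight a C x)%:E)%E.
Proof.
move=> mB.
have -> : P (X i @^-1` B) = (\int[mu]_(x in B) (gamma_pdf alpha x)%:E)%E := hdens i mB.
have mw := measurable_weight a C.
have mg : measurable_fun [set: mR] (gamma_pdf alpha : mR -> R).
  rewrite (_ : gamma_pdf alpha = fun x => (0 < x)%R%:R * (C * expR (- x) * x ^+ a)).
    apply: measurable_funM; first exact: measurable_indr_lt.
    apply: measurable_funM; last exact: measurable_funX.
    by apply: measurable_funM => //; exact: measurable_expRN.
  by apply/funext => x; rewrite /gamma_pdf; case: ifP; rewrite ?mul1r ?mul0r.
have D1 (f : mR -> R) : measurable_fun [set: mR] f ->
    (\int[mu]_(x in B) (f x)%:E = \int[mu]_(x in B `\ 0%R) (f x)%:E)%E.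
  move=> mf; rewrite (@integral_setD1 _ (EFin \o f))//.
    exact: (measurableD mB (@measurable_set1 R 0)).
  by apply: measurable_funTS; apply/measurable_EFinP.
rewrite (D1 _ mg) (D1 _ mw).
apply: eq_integral => x; rewrite inE => -[_ /= /eqP x0].
by rewrite gamma_pdf_weight.
Qed.

Lemma prob_gt0 i : P [set w | 0 < X i w] = 1%E.
Proof.
have mB : measurable (`]-oo, 0%R] : set mR) by [].
have -> : [set w | 0 < X i w] = ~` (X i @^-1` `]-oo, 0%R]).
  by apply/seteqP; split => w /=; rewrite in_itv/= leNgt; [move=> ->|move/negP/negPn].
rewrite probability_setC; last exact: (measurable_funPTI (X i) mB).
have -> : P (X i @^-1` `]-oo, 0%R]) =
    (\int[mu]_(x in `]-oo, 0%R]) (gamma_pdf alpha x)%:E)%E := hdens i mB.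
rewrite integral0_eq ?sube0// => x /=; rewrite in_itv/= /gamma_pdf leNgt => /negbTE ->.
by [].
Qed.

Let n_gt0 : (0 < n)%N. Proof. exact: ltnW. Qed.

Lemma measurable_sum_gt0 : measurable [set w | 0 < (stat X n w).1].
Proof.
have mf : measurable_fun setT (fun w => (stat X n w).1 : mR).
  by apply: (measurableT_comp measurable_fst); exact: measurable_stat.
have := mf measurableT `]0, +oo[%classic (measurable_itv _).
by rewrite setTI; congr measurable; apply/seteqP; split => w /=; rewrite in_itv/= andbT.
Qed.

Lemma prob_sum_gt0 : P [set w | 0 < (stat X n w).1] = 1%E.
Proof.
have mpos : measurable (`]0%R, +oo[ : set mR) by [].
apply/eqP; rewrite eq_le probability_le1/=; last exact: measurable_sum_gt0.
have := hX [set: 'I_n]%SET (fun=> mpos).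
rewrite [X in _ = X](_ : _ = 1%E); last first.
  apply: big1 => i _; rewrite -(prob_gt0 i); congr (P _).
  by apply/seteqP; split => w /=; rewrite in_itv/= andbT.
move=> <-; apply: le_measure.
- rewrite inE; apply: fin_bigcap_measurable => // i _.
  exact: (measurable_funPTI (X i) mpos).
- by rewrite inE; exact: measurable_sum_gt0.
- move=> w wX; rewrite /= stat_sumsE/=.
  have Xi i : 0 < X i w.
    have iT : i \in [set: 'I_n]%SET by rewrite inE.
    by have := wX i iT; rewrite /= in_itv/= andbT.
  rewrite (bigD1 (Ordinal n_gt0))//= ltr_pwDl// sumr_ge0// => i _.
  exact: ltW.
Qed.

Definition cap_indicator (t : R) : mR * mR -> \bar R := fun z =>
  ((0 < z.1)%R%:R * ((0 <= z.2)%R%:R * (z.2 <= t ^+ 2 * z.1 ^+ 2 / n%:R)%R%:R))%:E.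

(** The inner integral over the dispersion, divided by [s ^ (alpha n - 1) exp (- s)]. *)
Definition cap_poly (t : R) : R := \sum_(j < N.+1)
  shape_coef a n.-1 j * (2 / (n - 1 + 2 * j)%:R *
    (t / Num.sqrt n%:R) ^+ (n - 1 + 2 * j) / hgamma (n - 1 + 2 * j)).

Lemma measurable_cap_indicator t : measurable_fun [set: mR * mR] (cap_indicator t).
Proof.
apply/measurable_EFinP/measurable_funM; first exact: measurable_indr_lt.
apply: measurable_funM; first exact: measurable_indr_le.
apply: measurable_indr_le => //; apply: measurable_funM => //.
by apply: measurable_funM => //; exact: measurable_funX.
Qed.

Lemma cap_indicator_ge0 t z : (0 <= cap_indicator t z)%E.
Proof. by rewrite lee_fin. Qed.

(** The sum is almost surely positive, so the part of the event where the tangent is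
nonpositive can be dropped. *)
Lemma prob_event t : 0 <= t -> P [set w | tan (angle (fun i => X i w) (fun=> 1)) <= t] =
  (\int[P]_w cap_indicator t (stat X n w))%E.
Proof.
move=> t0.
have nR : 0 < n%:R :> R by rewrite ltr0n.
pose E1 := [set w | 0 < (stat X n w).1].
pose E2 := [set w | (stat X n w).2 <= t ^+ 2 * (stat X n w).1 ^+ 2 / n%:R].
have m1 : measurable E1 := measurable_sum_gt0.
have m2 : measurable E2.
  have mf : measurable_fun setT (fun w => stat X n w) by exact: measurable_stat.
  have mg : measurable_fun [set: mR * mR] (fun z => z.2 <= t ^+ 2 * z.1 ^+ 2 / n%:R).
    apply: measurable_fun_ler => //; apply: measurable_funM => //.
    by apply: measurable_funM => //; exact: measurable_funX.
  have mt : measurable [set true] by [].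
  by have := (measurableT_comp mg mf) measurableT _ mt; rewrite setTI.
have evE : [set w | tan (angle (fun i => X i w) (fun=> 1)) <= t] = ~` E1 `|` (E1 `&` E2).
  apply/seteqP; split => w; rewrite /E1 /E2 /= tan_angle_ones_le// stat_sumsE /=;
    set S := \sum_i X i w; set Q := \sum_i X i w ^+ 2;
    have -> : (n%:R * Q <= (1 + t ^+ 2) * S ^+ 2) = (Q - S ^+ 2 / n%:R <= t ^+ 2 * S ^+ 2 / n%:R)
      by rewrite lerBlDr -mulrDl ler_pdivlMr// (mulrC Q); congr (_ <= _); ring.
    by case: (ltP 0 S) => S0 /= H; [right|left].
  by case=> [/negP/negbTE -> //|[-> ->]]; rewrite implybT.
have PE1 : P (~` E1) = 0%E.
  by rewrite (probability_setC P m1) [P E1]prob_sum_gt0 subee.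
transitivity (P (~` E1) + P (E1 `&` E2))%E.
  rewrite evE; apply: measureU; [exact: measurableC|exact: measurableI|].
  by rewrite setIA setICl set0I.
have m12 : measurable (E1 `&` E2) := measurableI _ _ m1 m2.
rewrite PE1 add0e -[E1 `&` E2]setIT -integral_indic//.
apply: eq_integral => w _; rewrite /cap_indicator indicE; congr EFin.
rewrite stat_ge0 mul1r -natrM mulnb; congr (_%:R); congr nat_of_bool.
by rewrite in_setI !mem_setE.
Qed.

(** The hypothesis on [t] puts the cap inside the cone.  There the density is
homogeneous, so the integral over the dispersion splits off a power of the sum,
and the sum is integrated by Euler's integral. *)
Lemma integral_cap_indicator t : 0 <= t -> (n%:R - 1) * t ^+ 2 <= 1 ->
  (\int[P]_w cap_indicator t (stat X n w) = (C ^+ n * (gamma (alpha * n)%:R * cap_poly t))%:E)%E.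
Proof.
move=> t0 nt.
have n1 : n.-1.+1 = n by rewrite prednK.
have nR : 0 < n%:R :> R by rewrite ltr0n.
have aN : (a * n.-1.+1 <= (2 * N).+1)%N.
  by rewrite n1 /N /poly_order -/a; have := odd_double_half (a * n); lia.
have Fc z : ~~ cone n.-1.+1 z -> cap_indicator t z = 0%E.
  rewrite n1 /cap_indicator /cone; case: (ltP 0 z.1) => [z1 /=|_ _]; last by rewrite mul0r.
  case: (leP 0 z.2) => [z2 /=|_ _]; last by rewrite mul0r mulr0.
  case: (leP z.2 _) => [z12|_ _]; last by rewrite !mulr0.
  move=> /negP[]; apply: le_trans (_ : n%:R * (n%:R - 1) * (t ^+ 2 * z.1 ^+ 2 / n%:R) <= _).
    by rewrite ler_wpM2l// mulr_ge0 ?subr_ge0 ?ler1n.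
  have -> : n%:R * (n%:R - 1) * (t ^+ 2 * z.1 ^+ 2 / n%:R) = (n%:R - 1) * t ^+ 2 * z.1 ^+ 2.
    by field; rewrite gt_eqF.
  by rewrite -[leRHS]mul1r ler_wpM2r// sqr_ge0.
have n10 : (0 < n.-1)%N by rewrite -ltnS n1.
have n1n : (n.-1 < n)%N by rewrite prednK.
have := cone_law_stat hX C_ge0 prob_weight n10 n1n aN (measurable_cap_indicator t) (cap_indicator_ge0 t) Fc.
rewrite n1 => ->; rewrite [RHS]EFinM; congr (_ * _)%E.
have q0 j : (0 < n - 1 + 2 * j)%N by rewrite addn_gt0 subn_gt0 hn.
pose c (j : 'I_N.+1) s : R := expR (- s) * (shape_coef a n.-1 j * s ^+ (a * n - 2 * j)).
have inner s : (\int[mu]_w (cap_indicator t (s, w) * (expR (- s) * cone_density a N n.-1 s w)%:E) =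
    (cap_poly t * ((0 < s)%R%:R * (s ^+ (alpha * n).-1 * expR (- s))))%:E)%E.
  have [s0|s0] := ltP 0 s; last first.
    rewrite mul0r mulr0; apply: integral0_eq => w _.
    by rewrite /cap_indicator/= ltNge s0/= mul0r mul0e.
  pose th := t ^+ 2 * s ^+ 2 / n%:R.
  have th0 : 0 <= th.
    by apply: mulr_ge0; [apply: mulr_ge0; exact: sqr_ge0|rewrite invr_ge0 ltW].
  transitivity (\int[mu]_w (\sum_(j < N.+1) c j s *
      (phi (n - 1 + 2 * j) w * (w <= th)%R%:R))%:E)%E.
    apply: eq_integral => w _; have [w0|w0] := leP w 0.
      rewrite cone_density_le0// mulr0 mule0 big1// => j _.
      by rewrite phi_le0// mul0r mulr0.
    case: (leP w th) => wth; last first.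
      rewrite [cap_indicator t _](_ : _ = 0%E) ?mul0e.
        by rewrite big1// => j _; rewrite !mulr0.
      have wthN : (w <= th) = false by rewrite leNgt wth.
      by rewrite /cap_indicator/= -/th wthN !mulr0.
    have cap1 : cap_indicator t (s, w) = 1%E by rewrite /cap_indicator/= -/th s0 (ltW w0) wth !mul1r.
    have cz : cone n.-1.+1 (s, w).
      apply/negPn/negP => /Fc; rewrite cap1 => /eqP; rewrite eqe oner_eq0//.
    rewrite cap1 mul1e /cone_density cz mul1r /shape_density mulr_sumr; congr EFin.
    by apply: eq_bigr => j _; rewrite /c mulr1 n1 subn1; ring.
  rewrite (@integral_lincomb _ _ _ _ _ (fun j : 'I_N.+1 => 2 / (n - 1 + 2 * j)%:R *
      Num.sqrt th ^+ (n - 1 + 2 * j) / hgamma (n - 1 + 2 * j)))//; last 3 first.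
  - move=> j; apply: measurable_funM; first exact: measurable_phi.
    exact: measurable_indr_le.
  - by move=> j w; apply: mulr_ge0; [exact: phi_ge0|].
  - by move=> j; exact: integral_phi_le.
  congr EFin; rewrite /cap_poly mulr_suml; apply: eq_bigr => j _.
  have [aj|aj] := ltnP (a * n) (2 * j).
    by rewrite /c shape_coef_eq0 ?n1// !(mul0r, mulr0).
  have -> : Num.sqrt th = t / Num.sqrt n%:R * s.
    have -> : th = (t / Num.sqrt n%:R * s) ^+ 2.
      by rewrite !exprMn exprVn sqr_sqrtr ?(ltW nR)// /th; ring.
    rewrite sqrtr_sqr ger0_norm//; apply: mulr_ge0; last exact: ltW.
    by apply: mulr_ge0 => //; rewrite invr_ge0 sqrtr_ge0.
  have -> : (alpha * n).-1 = (a * n - 2 * j + (n - 1 + 2 * j))%N.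
    by rewrite /a; move: halpha aj hn; rewrite /a; nia.
  by rewrite exprMn (exprD s (a * n - 2 * j)) /c mul1r; ring.
transitivity (\int[mu]_s (\sum_(i <- [:: tt]) cap_poly t *
    ((0 < s)%R%:R * (s ^+ (alpha * n).-1 * expR (- s))))%:E)%E.
  by apply: eq_integral => s _; rewrite big_seq1 -inner.
rewrite (@integral_lincomb _ _ _ (fun=> cap_poly t) (fun _ s => (0 < s)%R%:R *
    (s ^+ (alpha * n).-1 * expR (- s))) (fun=> gamma (alpha * n)%:R)).
- by rewrite big_seq1 mulrC.
- move=> _; apply: measurable_funM; first exact: measurable_indr_lt.
  by apply: measurable_funM; [exact: measurable_funX|exact: measurable_expRN].
- move=> _ s; case: (ltP 0 s) => s0; last by rewrite mul0r.
  by rewrite mul1r mulr_ge0 ?expR_ge0// exprn_ge0// ltW.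
- by move=> _; rewrite integral_expR_pow// muln_gt0 halpha.
Qed.

End cap_probability.

Theorem theorem3p1 (R : realType) (d : measure_display) (T : measurableType d)
    (P : probability T R) (alpha n : nat) (X : 'I_n -> {RV P >-> R})
    (halpha : (1 <= alpha)%N) (hn : (2 <= n)%N)
    (hX : independent_RVs X)
    (hdens : forall i, has_density (X i) (gamma_pdf alpha)) :
  exists a : {ffun 'I_(poly_order alpha n).+1 -> R},
    unique (@coef_system R alpha n) a /\
    forall t : R, 0 <= t <= (n%:R - 1) `^ (- (1 / 2)) ->
      P [set w | tan (angle (fun i => X i w) (fun=> 1)) <= t] =
      (gamma (alpha * n)%:R /
         (gamma alpha%:R ^+ n * n%:R `^ ((alpha * n)%:R / 2)) *
       \sum_(j < (poly_order alpha n).+1)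
          a j * (t ^+ (n - 1 + 2 * j) / (n - 1 + 2 * j)%:R))%:E.
Proof.
exists (@coef_sol R alpha n); split; first exact: coef_sol_unique.
move=> t /andP[t0 tn].
have n0 : (0 < n)%N by exact: ltnW.
have nR : 0 < n%:R :> R by rewrite ltr0n.
have n1R : 0 < n%:R - 1 :> R by rewrite subr_gt0 ltr1n.
have nt : (n%:R - 1) * t ^+ 2 <= 1.
  rewrite mulrC -ler_pdivlMr// mul1r; apply: le_trans (_ : ((n%:R - 1) `^ (- (1 / 2))) ^+ 2 <= _).
    by rewrite ler_pXn2r ?nnegrE// powR_ge0.
  by rewrite powRN mul1r powR12_sqrt ?(ltW n1R)// exprVn sqr_sqrtr ?(ltW n1R).
rewrite (prob_event hn hX hdens t0) (integral_cap_indicator halpha hn hX hdens t0 nt).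
congr EFin; rewrite /cap_poly.
have -> : n%:R `^ ((alpha * n)%:R / 2) = Num.sqrt n%:R ^+ (alpha * n) :> R.
  by rewrite mulrC powRrM powR12_sqrt ?(ltW nR)// powR_mulrn ?sqrtr_ge0.
rewrite exprVn invfM mulrCA -!mulrA; congr (_ * (_ * _)).
rewrite mulr_sumr; apply: eq_bigr => j _; rewrite ffunE.
have jN : (2 * j <= (alpha - 1) * n)%N.
  have := ltn_ord j; rewrite /poly_order; have := odd_double_half ((alpha - 1) * n); lia.
have e : (alpha * n = ((alpha - 1) * n - 2 * j).+1 + (n - 1 + 2 * j))%N.
  by move: jN halpha hn; nia.
rewrite exprMn exprVn [in RHS]e (exprD _ ((alpha - 1) * n - 2 * j).+1).
have sN k : Num.sqrt n%:R ^+ k != 0 :> R by rewrite expf_neq0// gt_eqF// sqrtr_gt0.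
have hN : hgamma (n - 1 + 2 * j) != 0 :> R by rewrite gt_eqF// hgamma_gt0//; lia.
have qN : (n - 1 + 2 * j)%:R != 0 :> R by rewrite pnatr_eq0; lia.
move: (n - 1 + 2 * j)%N ((alpha - 1) * n - 2 * j).+1 hN qN => q r hN qN.
by field; rewrite !sN hN qN.
Qed.
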